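(* Let $\epsilon>0$ be fixed. There is a randomized LOCAL algorithm that, on any instance $(G=(L\cup R,E),\mathsf{C})$ of the allocation problem whose graph $G$ has arboricity $\lambda$, computes a $(1+\epsilon)$-approximate (integral) allocation, i.e. an allocation $M$ with $(1+\epsilon)|M|\ge |M^\star|$ where $M^\star$ is a maximum allocation, in $O_\epsilon(\log\lambda)$ rounds.
   Context: Allocation problem: the input is a bipartite graph $G=(L\cup R,E)$ with known bipartition and integer capacities $\mathsf{C}_v\ge 1$ for $v\in R$. An allocation is a set $M\subseteq E$ such that every $u\in L$ is incident to at most one edge of $M$ and every $v\in R$ is incident to at most $\mathsf{C}_v$ edges of $M$; the goal is to maximize $|M|$. The arboricity $\lambda$ of $G$ is the minimum number of forests into which $E$ can be partitioned. LOCAL model: the communication network is $G$ itself; each vertex has a processor with unbounded memory and a unique $O(\log n)$-bit identifier; computation proceeds in synchronous rounds, in each of which every vertex receives the messages sent to it in the previous round, performs arbitrary local computation, and sends messages of arbitrary size to its neighbors. The complexity is the number of rounds. $O_\epsilon(\cdot)$ hides factors depending only on $\epsilon$. *)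

(* Defs.v *)
From HB Require Import structures.
From mathcomp Require Import all_boot all_order all_algebra.
From mathcomp Require Import all_classical all_reals all_analysis.

Set Implicit Arguments.
Unset Strict Implicit.
Unset Printing Implicit Defensive.
Import Order.TTheory GRing.Theory Num.Theory.
Local Open Scope ring_scope.

Record instance := Instance {
  lpart : finType;
  rpart : finType;
  edges : {set lpart * rpart};
  cap : rpart -> nat;
  cap_gt0 : forall v, (0 < cap v)%N }.

Definition vertex (G : instance) : finType := (lpart G + rpart G)%type.

Definition adj (L R : finType) (F : {set L * R}) : rel (L + R) :=
  fun x y => match x, y with
             | inl u, inr v | inr v, inl u => (u, v) \in F
             | _, _ => false
             end.

Definition allocation (G : instance) (M : {set lpart G * rpart G}) : bool :=
  [&& M \subset edges G,
      [forall u, #|[set e in M | e.1 == u]| <= 1]%N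
    & [forall v, #|[set e in M | e.2 == v]| <= cap v]%N].

Arguments allocation : clear implicits.

Definition opt (G : instance) : nat := \max_(M | allocation G M) #|M|.

(* [ucycle] admits degenerate cycles: [::] and, for an edge xy, [:: x; y].
   The genuine cycles of a simple graph are those of length at least 3. *)
Definition forest (L R : finType) (F : {set L * R}) : Prop :=
  forall c : seq (L + R), ucycle (adj F) c -> (size c <= 2)%N.

Definition forest_partition (G : instance) (P : {set {set lpart G * rpart G}})
  : Prop :=
  finset.partition P (edges G) /\ forall F, F \in P -> forest F.

Arguments forest_partition : clear implicits.

Definition arboricity (G : instance) (lam : nat) : Prop :=
  (exists2 P, forest_partition G P & #|P| = lam) /\
  (forall P : {set {set lpart G * rpart G}}, forest_partition G P ->
     (lam <= #|P|)%N).

(* A LOCAL algorithm, i.e. the program run by every vertex.  State space,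
   message space and local computations are unrestricted.
   - [init lam i c w] is the initial state of the vertex with identifier [i] in
     a graph of arboricity [lam]; [c] is [None] for a vertex of the left part
     and [Some k] for a vertex of the right part with capacity [k]; [w] is the
     private infinite sequence of random bits of the vertex.
   - [send s j] is the message sent by a vertex in state [s] to its neighbour
     with identifier [j], if there is one.  A vertex is not told the
     identifiers of its neighbours: it emits a whole table of messages, indexed
     by the possible identifiers of the recipient.
   - [recv s m] is the next state, where [m] lists the received messages, each
     with the identifier of its sender.
   - every vertex halts after [rounds lam] rounds.
   - [output s j] tells whether the edge to the neighbour with identifier [j]
     is selected.
   The arboricity is global knowledge, on which the halting time depends; the
   number of vertices is not. *)
Record algorithm := Algorithm {
  state : Type;
  msg : Type;
  init : nat -> nat -> option nat -> (nat -> bool) -> state;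
  send : state -> nat -> msg;
  recv : state -> seq (nat * msg) -> state;
  rounds : nat -> nat;
  output : state -> nat -> bool }.

Section Execution.
Variables (A : algorithm) (G : instance) (lam : nat) (id : vertex G -> nat).

Definition local_input (x : vertex G) : option nat :=
  match x with inl _ => None | inr v => Some (cap v) end.

(* Sorting by identifier keeps the inbox independent of the enumeration of the
   vertex type. *)
Definition neighbours (x : vertex G) : seq (vertex G) :=
  sort (relpre id leq) (enum (adj (edges G) x)).

Definition inbox (s : vertex G -> state A) (x : vertex G) : seq (nat * msg A) :=
  [seq (id y, send (s y) (id x)) | y <- neighbours x].

Definition round (s : vertex G -> state A) : vertex G -> state A :=
  fun x => recv (s x) (inbox s x).

Definition final (coins : vertex G -> nat -> bool) : vertex G -> state A :=
  iter (rounds A lam) round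
    (fun x => init A lam (id x) (local_input x) (coins x)).

(* Both endpoints of every edge must know whether it belongs to [M]. *)
Definition computes (coins : vertex G -> nat -> bool)
    (M : {set lpart G * rpart G}) : Prop :=
  M \subset edges G /\
  forall u v, (u, v) \in edges G ->
    output (final coins (inl u)) (id (inr v)) = ((u, v) \in M) /\
    output (final coins (inr v)) (id (inl u)) = ((u, v) \in M).

Definition computes_approx (R : realType) (eps : R)
    (coins : vertex G -> nat -> bool) : Prop :=
  exists M, [/\ computes coins M, allocation G M
              & (opt G)%:R <= (1 + eps) * #|M|%:R].

End Execution.

(* The bits [coin x i] are independent and fair: each outcome of the first [B]
   bits of all the [x : V] has the same probability. *)
Definition fair_coins (R : realType) (d : measure_display)
    (Omega : measurableType d) (P : probability Omega R) (V : finType)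
    (coin : V -> nat -> Omega -> bool) : Prop :=
  (forall x i, measurable [set w | coin x i w]%classic) /\
  (forall (B : nat) (b : V -> nat -> bool),
     P [set w | forall x i, (i < B)%N -> coin x i w = b x i]%classic =
     ((2^-1 : R) ^+ (#|V| * B))%:E).

(* Main.v *)
Require Import Defs.
From HB Require Import structures.
From mathcomp Require Import all_boot all_order all_algebra.
From mathcomp Require Import all_classical all_reals all_analysis.
From mathcomp Require Import zify ring lra.

(** With parameters [e = 1 / k] and [s = k ^ 2], the algorithm has three phases.

    Fractional phase.  Every [v] in the right part carries a weight
    [(1 + e) ^- level v], every [u] in the left part splits one unit among its
    neighbours proportionally to their weights, and [v] raises its level as long
    as it receives more than its capacity.  A vertex that has raised its level
    stays almost saturated, one that has once refrained from raising it is never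
    overloaded by more than a factor [1 + e].  For a threshold [th], the vertices
    of level at least [th] and the neighbours of the others form a cover.  What
    these neighbours send to vertices at least [w] levels above [th] is at most
    [(1 + e) ^- w] per edge, and the number of edges is at most the arboricity
    times the size of the cover; the levels between [th] and [th + w] are counted
    twice.  Averaging over [k] disjoint windows, the cover is within [1 + O(e)] of
    the fractional value once the number of rounds is [k * w = O(log lam)].

    Sampling phase.  Every [u] draws [s] tokens from its fractional assignment,
    scaled so that every [v] expects at most [(1 - e) s C_v] tokens; by Chebyshev
    the expected number of tokens beyond [s C_v] is a small fraction of the total.

    Auction phase.  A free [u] bids for a cheapest [v] among its tokens, as long
    as some price is below [k]; [v] keeps the last [C_v] bids it has accepted, and
    its price is the number of accepted bids divided by [C_v].  The number of bids
    is controlled by the prices and the number of tokens at each [v], so a number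
    of rounds depending only on [k] suffices, and averaging over the price
    thresholds again yields a cover certifying a [1 + O(e)] approximation.

    The expected deficit is thus [O(e)] times the optimum, and Markov's inequality
    gives the success probability. *)

Set Implicit Arguments.
Unset Strict Implicit.
Unset Printing Implicit Defensive.
Import Order.TTheory GRing.Theory Num.Theory.
Local Open Scope ring_scope.

(** * Arboricity and edge density *)

Lemma card_bigcup_leq (I T : finType) (P : pred I) (F : I -> {set T}) :
  (#|\bigcup_(i | P i) F i| <= \sum_(i | P i) #|F i|)%N.
Proof.
apply: (big_ind2 (fun (S : {set T}) n => #|S| <= n)%N) => //; first by rewrite cards0.
move=> S m S' n leSm leSn.
by apply: leq_trans (leq_add leSm leSn); rewrite -cardsUI leq_addr.
Qed.

(** The first vertex of a longest simple path is a leaf: another neighbour would either prolong the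
    path or, lying on it, close a cycle of length at least 3. *)
Lemma exists_leaf (T : finType) (e : rel T) (x0 y0 : T) :
  symmetric e -> irreflexive e -> e x0 y0 ->
  (forall c, ucycle e c -> (size c <= 2)%N) ->
  exists x y, forall z, e x z = (z == y).
Proof.
move=> e_sym e_irr e0 acyclic.
pose ok n := `[<exists x y p, [/\ path e x (y :: p), uniq (x :: y :: p) & size p = n]>].
have ok0 : exists n, ok n.
  exists 0%N; apply/asboolP; exists x0, y0, [::]; split=> //=; first by rewrite e0.
  by rewrite inE andbT; apply: contraTneq e0 => ->; rewrite e_irr.
have ok_bound n : ok n -> (n <= #|T|)%N.
  move=> /asboolP [x [y [p [_ /andP[_ /andP[_ up]] <-]]]].
  by rewrite -(card_uniqP up) max_card.
case: (ex_maxnP ok0 ok_bound) => n /asboolP [x [y [p [xp up sp]]]] n_max.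
exists x, y => z; apply/idP/eqP => [exz | ->]; last by case/andP: xp.
apply/eqP/negPn/negP => z_y.
have zp : z \in p.
  apply/negPn/negP => zNp.
  have: ok n.+1; last by move/n_max; rewrite ltnn.
  apply/asboolP; exists z, x, (y :: p); split; last by rewrite /= sp.
    by rewrite /= e_sym exz; exact: xp.
  rewrite cons_uniq up andbT !inE !negb_or zNp z_y !andbT.
  by apply: contraTneq exz => ->; rewrite e_irr.
case/splitPr: zp xp up {sp} => p1 p2 /= /andP[exy]; rewrite cat_path /=.
case/and3P=> yp1 p1z _ /andP[]; rewrite -cat_rcons inE mem_cat !negb_or.
case/and3P=> x_y xNp1 _ /andP[]; rewrite mem_cat negb_or => /andP[yNp1 _].
rewrite cat_uniq => /andP[up1 _].
have /acyclic : ucycle e (x :: y :: rcons p1 z); last by rewrite /= size_rcons.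
rewrite /ucycle /= rcons_path last_rcons rcons_path exy yp1 p1z e_sym exz.
by rewrite inE negb_or x_y xNp1 yNp1.
Qed.

(** Induction on the number of edges: deleting the only edge at a leaf also allows the leaf to be
    deleted from [A] or [B]. *)
Lemma card_forest (L R : finType) (F : {set L * R}) (A : {set L}) (B : {set R}) :
  forest F -> F \subset finset.setX A B -> (#|F| <= #|A| + #|B|)%N.
Proof.
elim: {F}#|F| {-2}F (erefl #|F|) A B => [|n IH] F cF A B forestF FAB.
  by rewrite cF.
have [/= [u0 v0] uv0] : exists e, e \in F by apply/card_gt0P; rewrite cF.
have adj_sym : symmetric (adj F) by case=> [?|?] [?|?].
have adj_irr : irreflexive (adj F) by case.
have [x [y leaf]] := exists_leaf (x0 := inl u0) (y0 := inr v0) adj_sym adj_irr uv0 forestF.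
have leafxy : adj F x y by rewrite leaf.
have forestS (F' : {set L * R}) : F' \subset F -> forest F'.
  move=> sF' c /andP[cyc uc]; apply: forestF; rewrite /ucycle uc andbT.
  apply: sub_cycle cyc => -[a|a] [b|b] //=; exact: fintype.subsetP.
have [e eF eP] : exists2 e, e \in F &
    match x with inl u => e.1 = u /\ (forall v, (u, v) \in F -> (u, v) = e)
    | inr v => e.2 = v /\ (forall u, (u, v) \in F -> (u, v) = e) end.
  case: x y leaf leafxy => [u|v] [u'|v'] //= leaf leafxy.
    exists (u, v') => //=; split=> // v uvF.
    by have := leaf (inr v); rewrite /= uvF => /esym/eqP [->].
  exists (u', v) => //=; split=> // u uvF.
  by have := leaf (inl u); rewrite /= uvF => /esym/eqP [->].
have cF' : #|F :\ e| = n by have := cardsD1 e F; rewrite eF cF add1n => -[].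
have := fintype.subsetP FAB e eF; rewrite inE => /andP[eA eB].
have sFe : F :\ e \subset F by apply: subsetDl.
rewrite cF; case: x {leaf leafxy} eP => [u|v] [ex eP].
- rewrite ex in eA; rewrite (cardsD1 u A) eA add1n addSn ltnS -cF'.
  apply: IH => //; first exact: forestS.
  apply/fintype.subsetP => -[u' v']; rewrite !inE /= => /andP[ne uvF].
  have := fintype.subsetP FAB _ uvF; rewrite inE /= => /andP[-> ->]; rewrite !andbT.
  by apply: contraNneq ne => uu; rewrite uu in uvF *; rewrite (eP _ uvF).
- rewrite ex in eB; rewrite (cardsD1 v B) eB add1n addnS ltnS -cF'.
  apply: IH => //; first exact: forestS.
  apply/fintype.subsetP => -[u' v']; rewrite !inE /= => /andP[ne uvF].
  have := fintype.subsetP FAB _ uvF; rewrite inE /= => /andP[-> ->]; rewrite !andbT.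
  by apply: contraNneq ne => uu; rewrite uu in uvF *; rewrite (eP _ uvF).
Qed.

(** Each of the [lam] forests restricts to a forest between [A] and [B], to which [card_forest]
    applies. *)
Lemma arboricity_density (G : instance) (lam : nat)
    (A : {set lpart G}) (B : {set rpart G}) :
  arboricity G lam -> (#|edges G :&: finset.setX A B| <= lam * (#|A| + #|B|))%N.
Proof.
case=> [[P [partP forestP] <-] _]; case/and3P: partP => /eqP covP triv _.
have -> : edges G :&: finset.setX A B = \bigcup_(F in P) (F :&: finset.setX A B).
  by rewrite -covP /cover -big_distrl.
rewrite -sum_nat_const.
apply: (leq_trans (card_bigcup_leq _ _)).
apply: leq_sum => F FP.
apply: card_forest; last exact: subsetIr.
move=> c /andP[cyc uc]; apply: (forestP F FP); rewrite /ucycle uc andbT.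
by apply: sub_cycle cyc => -[a|a] [b|b] //=; rewrite inE => /andP[].
Qed.

(** * The fractional phase *)

Section Proportional.
Variables (K : realType) (L R : finType) (E : {set L * R}) (C : R -> nat) (e : K).
Hypotheses (e_gt0 : 0 < e) (C_gt0 : forall v, (0 < C v)%N).

Definition wgt (n : nat) : K := (1 + e) ^- n.
Definition lwt (f : R -> nat) (u : L) : K := \sum_(v | (u, v) \in E) wgt (f v).
Definition alloc (f : R -> nat) (v : R) : K :=
  \sum_(u | (u, v) \in E) wgt (f v) / lwt f u.
Definition raise (f : R -> nat) (v : R) : nat :=
  if (C v)%:R < alloc f v then (f v).+1 else f v.
Definition level (t : nat) : R -> nat := iter t raise (fun=> 0%N).

Let e1_gt0 : 0 < 1 + e. Proof. by rewrite ltr_wpDl ?ler01. Qed.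

Lemma wgt_gt0 n : 0 < wgt n. Proof. by rewrite invr_gt0 exprn_gt0. Qed.

Lemma wgtS n : wgt n.+1 = wgt n / (1 + e).
Proof. by rewrite /wgt exprS invfM mulrC. Qed.

Lemma ler_wgt m n : (m <= n)%N -> wgt n <= wgt m.
Proof.
move=> mn; rewrite lef_pV2 ?posrE ?exprn_gt0 //.
by rewrite ler_eXn2l // ltrDl.
Qed.

Lemma raise_ge f v : (f v <= raise f v <= (f v).+1)%N.
Proof. by rewrite /raise; case: ifP => _; rewrite !leqnn leqnSn. Qed.

Lemma lwt_ge0 f u : 0 <= lwt f u.
Proof. by apply: sumr_ge0 => v _; rewrite ltW ?wgt_gt0. Qed.

Lemma lwt_gt0 f u v : (u, v) \in E -> 0 < lwt f u.
Proof.
move=> uv; rewrite /lwt (bigD1 v) //= ltr_pwDl ?wgt_gt0 //.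
by apply: sumr_ge0 => i _; rewrite ltW ?wgt_gt0.
Qed.

Lemma lwt_raise f u : lwt f u / (1 + e) <= lwt (raise f) u <= lwt f u.
Proof.
rewrite /lwt mulr_suml; apply/andP; split; apply: ler_sum => v _.
  by rewrite -wgtS ler_wgt //; case/andP: (raise_ge f v).
by rewrite ler_wgt //; case/andP: (raise_ge f v).
Qed.

Lemma alloc_ge0 f v : 0 <= alloc f v.
Proof.
by apply: sumr_ge0 => u _; rewrite divr_ge0 ?lwt_ge0 // ltW ?wgt_gt0.
Qed.

Lemma alloc_gt0 f u v : (u, v) \in E -> 0 < alloc f v.
Proof.
move=> uv; rewrite /alloc (bigD1 u) //= ltr_pwDl ?divr_gt0 ?wgt_gt0 ?(lwt_gt0 _ uv) //.
by apply: sumr_ge0 => i _; rewrite divr_ge0 ?lwt_ge0 // ltW ?wgt_gt0.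
Qed.

(** The weight of [v] is unchanged while each denominator [lwt f u] shrinks, by a factor at most
    [1 + e]. *)
Lemma alloc_stay f v : alloc f v <= (C v)%:R ->
  alloc f v <= alloc (raise f) v <= (1 + e) * alloc f v.
Proof.
rewrite leNgt => /negbTE sat.
rewrite /alloc mulr_sumr; apply/andP; split; apply: ler_sum => u uv;
  rewrite [raise f v]/raise sat; have /andP[lo hi] := lwt_raise f u;
  have W0 := lwt_gt0 f uv; have W1 := lwt_gt0 (raise f) uv.
  by rewrite ler_pM2l ?wgt_gt0 // lef_pV2 ?posrE.
rewrite mulrCA ler_pM2l ?wgt_gt0 // -[1 + e]invrK -invfM.
by rewrite lef_pV2 ?posrE ?mulr_gt0 ?invr_gt0 // mulrC.
Qed.

(** The weight of [v] shrinks by exactly [1 + e] and the denominators by at most that factor, so the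
    amount received cannot grow. *)
Lemma alloc_raise f v : (C v)%:R < alloc f v ->
  alloc f v / (1 + e) <= alloc (raise f) v <= alloc f v.
Proof.
move=> sat.
rewrite /alloc mulr_suml; apply/andP; split; apply: ler_sum => u uv;
  rewrite [raise f v]/raise sat wgtS; have /andP[lo hi] := lwt_raise f u;
  have W0 := lwt_gt0 f uv; have W1 := lwt_gt0 (raise f) uv.
  by rewrite mulrAC ler_pM2l ?divr_gt0 ?wgt_gt0 // lef_pV2 ?posrE.
rewrite -mulrA ler_pM2l ?wgt_gt0 // -invfM lef_pV2 ?posrE ?mulr_gt0 //.
by rewrite mulrC -ler_pdivrMr.
Qed.

(** Both bounds are invariants. A raise starts above the capacity and loses at most a factor
    [1 + e], and rounds without a raise only increase the amount. A round without a raise ends at no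
    more than [(1 + e) * C v], and raises only decrease the amount. *)
Lemma level_alloc t v :
  [/\ (level t v <= t)%N,
      (0 < level t v)%N -> (C v)%:R <= (1 + e) * alloc (level t) v
    & (level t v < t)%N -> alloc (level t) v <= (1 + e) * (C v)%:R].
Proof.
elim: t => [|t [le_t lo hi]]; first by [].
have -> : level t.+1 = raise (level t) by [].
have [/[dup] sat /alloc_stay /andP[s1 s2]|/[dup] sat /alloc_raise /andP[s1 s2]] :=
  lerP (alloc (level t) v) (C v)%:R.
  have -> : raise (level t) v = level t v by rewrite /raise ltNge sat.
  split; first exact: leqW.
    by move/lo => /le_trans; apply; rewrite ler_pM2l.
  by move=> _; apply: (le_trans s2); rewrite ler_pM2l.
have -> : raise (level t) v = (level t v).+1 by rewrite /raise sat.
split=> //.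
  by move=> _; apply: (le_trans (ltW sat)); rewrite mulrC -ler_pdivrMr.
by rewrite ltnS => /hi; apply: le_trans.
Qed.

(** The part of the received amount that fits in the capacity; its sum over [v] is the fractional
    value. *)
Definition sat (f : R -> nat) (v : R) : K := Num.min (C v)%:R (alloc f v).

Lemma sat_ge0 f v : 0 <= sat f v.
Proof. by rewrite le_min ler0n alloc_ge0. Qed.

(** Weak duality: each edge of [M] is charged to an endpoint in the cover, and no endpoint is
    charged beyond its capacity. *)
Lemma allocation_cover (M : {set L * R}) (A : {set L}) (B : {set R}) :
  (forall u, #|[set x in M | x.1 == u]| <= 1)%N ->
  (forall v, #|[set x in M | x.2 == v]| <= C v)%N ->
  (forall u v, (u, v) \in M -> (u \in A) || (v \in B)) ->
  (#|M| <= #|A| + \sum_(v in B) C v)%N.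
Proof.
move=> ML MR cov.
have -> : #|M| = (\sum_(x in M) 1)%N by rewrite sum1_card.
apply: (@leq_trans (\sum_(x in M | x.1 \in A) 1 + \sum_(x in M | x.2 \in B) 1)%N).
  rewrite !big_mkcondr -big_split /=; apply: leq_sum => -[u v] /cov /=.
  by case: (u \in A); case: (v \in B).
apply: leq_add.
  rewrite (partition_big (fun x => x.1) (mem A)) /=; last by move=> ? /andP[].
  rewrite -[#|A|]sum1_card; apply: leq_sum => u uA.
  apply: leq_trans (ML u); rewrite sum1_card subset_leq_card //.
  by apply/fintype.subsetP => x; rewrite !inE => /andP[/andP[-> _] ->].
rewrite (partition_big (fun x => x.2) (mem B)) /=; last by move=> ? /andP[].
apply: leq_sum => v vB.
apply: leq_trans (MR v); rewrite sum1_card subset_leq_card //.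
by apply/fintype.subsetP => x; rewrite !inE => /andP[/andP[-> _] ->].
Qed.

Lemma sum_alloc (f : R -> nat) (A : {set L}) :
  (forall u, u \in A -> exists v, (u, v) \in E) ->
  #|A|%:R = \sum_(u in A) \sum_(v | (u, v) \in E) wgt (f v) / lwt f u.
Proof.
move=> nA; rewrite -sum1_card natr_sum; apply: eq_bigr => u /nA[v uv].
by rewrite -mulr_suml divff // gt_eqF // (lwt_gt0 f uv).
Qed.

(** Each of the [k] thresholds [i * w] yields a cover whose cost is compared with the fractional
    value. The density bound absorbs the flow that skips the window above the threshold; averaging
    over [i] absorbs the window itself. *)
Lemma cover_value (lam k w : nat) (M : {set L * R}) :
  (forall (A : {set L}) (B : {set R}),
     (#|E :&: finset.setX A B| <= lam * (#|A| + #|B|))%N) ->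
  lam%:R * wgt w <= e ->
  M \subset E ->
  (forall u, #|[set x in M | x.1 == u]| <= 1)%N ->
  (forall v, #|[set x in M | x.2 == v]| <= C v)%N ->
  k%:R * (1 - e) * #|M|%:R <=
    (1 + e) * k.+1%:R * \sum_v sat (level (k * w).+1) v.
Proof.
move=> dens lam_w ME ML MR; set t := (k * w).+1; set f := level t.
pose mid i := \sum_(v | (i * w < f v <= i * w + w)%N) sat f v.
pose P := \sum_v sat f v.
(* The windows are disjoint, so the terms [mid i] add up to at most [P]; this is where the factor
   [k.+1] comes from. *)
suff step i : (i < k)%N -> (1 - e) * #|M|%:R <= (1 + e) * (P + mid i).
  have -> : k%:R * (1 - e) * #|M|%:R = \sum_(i < k) (1 - e) * #|M|%:R.
    by rewrite sumr_const card_ord -[RHS]mulr_natl mulrA.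
  apply: (@le_trans _ _ (\sum_(i < k) (1 + e) * (P + mid i))).
    by apply: ler_sum => i _; apply: step.
  rewrite -mulr_sumr -mulrA ler_pM2l // big_split /= sumr_const card_ord.
  rewrite -[P *+ k]mulr_natl -natr1 mulrDl mul1r lerD2l.
  rewrite /mid /P (exchange_big_dep xpredT) //=; apply: ler_sum => v _.
  have [[i0 i0P]|none] := pselect (exists i : 'I_k, (i * w < f v <= i * w + w)%N).
    rewrite (bigD1 i0) //= big1 ?addr0 // => i /andP[iP /eqP ne]; case: ne.
    apply/val_inj/eqP; rewrite eqn_leq /=; apply/andP; split; nia.
  by rewrite big1 ?sat_ge0 // => i iP; case: none; exists i.
move=> ik.
(* [low] holds the vertices above the threshold, thus of low weight, and [far] those beyond the
   window. With the neighbours [N] of the remaining vertices, [low] covers every edge. *)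
pose low := [set v | (i * w < f v)%N]; pose far := [set v | (i * w + w < f v)%N].
pose N := [set u | [exists v, ((u, v) \in E) && (f v <= i * w)%N]].
pose cost : K := #|N|%:R + \sum_(v in low) (C v)%:R.
(* The extra round in [t] makes this strict even for the last window, as the upper bound of
   [level_alloc] requires. *)
have iwt : (i * w + w < t)%N by rewrite /t ltnS -mulSnr leq_mul2r ik orbT.
have M_cost : #|M|%:R <= cost.
  rewrite /cost -natr_sum -natrD ler_nat; apply: allocation_cover => // u v uv.
  rewrite !inE; case: ltnP => [|le]; rewrite ?orbT // orbF.
  by apply/existsP; exists v; rewrite (fintype.subsetP ME _ uv).
suff : (1 - e) * cost <= (1 + e) * (P + mid i).
  move: M_cost e_gt0; have [e1 M_cost _|e1 _ _ _] := ltrP e 1.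
    by apply: le_trans; rewrite ler_wpM2l // subr_ge0 ltW.
  apply: (@le_trans _ _ 0); first by rewrite mulr_le0_ge0 // subr_le0.
  rewrite mulr_ge0 ?addr_ge0 ?sumr_ge0 // => [|v _|v _]; rewrite ?sat_ge0 //.
  exact: ltW.
suff : cost <= (1 + e) * (P + mid i) + e * cost by lra.
have low_sat : \sum_(v in low) (C v)%:R <= (1 + e) * \sum_(v in low) sat f v.
  rewrite mulr_sumr; apply: ler_sum => v; rewrite inE => vlow.
  have [_ lo _] := level_alloc t v.
  rewrite -ler_pdivrMl // le_min; apply/andP; split.
    by rewrite ler_pdivrMl // ler_peMl // lerDl ltW.
  by rewrite ler_pdivrMl // lo // (leq_ltn_trans _ vlow).
have near :
    \sum_(u in N) \sum_(v | ((u, v) \in E) && (v \notin far)) wgt (f v) / lwt f u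
    <= (1 + e) * \sum_(v | v \notin far) sat f v.
  apply: (@le_trans _ _ (\sum_(v | v \notin far) alloc f v)).
    rewrite (exchange_big_dep (fun v => v \notin far)) /=; last by move=> ? ? _ /andP[].
    apply: ler_sum => v vf; rewrite /alloc [leLHS]big_mkcond [leRHS]big_mkcond.
    apply: ler_sum => u _; rewrite vf andbT.
    have q0 : 0 <= wgt (f v) / lwt f u by rewrite divr_ge0 ?lwt_ge0 // ltW ?wgt_gt0.
    by case: (u \in N); case: ((u, v) \in E).
  rewrite mulr_sumr; apply: ler_sum => v; rewrite inE -leqNgt => vnear.
  have [_ _ hi] := level_alloc t v.
  rewrite -ler_pdivrMl // le_min; apply/andP; split.
    by rewrite ler_pdivrMl // hi // (leq_ltn_trans vnear).
  by rewrite ler_pdivrMl // ler_peMl ?alloc_ge0 // lerDl ltW.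
(* Every [u] in [N] has a neighbour [v'] at or below the threshold, so its denominator is at least
   [wgt (f v')], and a [far] vertex weighs at most [wgt w * wgt (f v')]. The edges between [N] and
   [far] are then counted by density, with [far] inside [low]. *)
have away :
    \sum_(u in N) \sum_(v | ((u, v) \in E) && (v \in far)) wgt (f v) / lwt f u
    <= e * cost.
  apply: (@le_trans _ _ (\sum_(u in N) \sum_(v | ((u, v) \in E) && (v \in far)) wgt w)).
    apply: ler_sum => u; rewrite inE => /existsP[v' /andP[uv' lev']].
    apply: ler_sum => v /andP[uv]; rewrite inE => fv.
    rewrite ler_pdivrMr ?(lwt_gt0 f uv) //.
    apply: (@le_trans _ _ (wgt w * wgt (f v'))); last first.
      rewrite ler_pM2l ?wgt_gt0 // /lwt (bigD1 v') //= lerDl sumr_ge0 // => z _.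
      by rewrite ltW ?wgt_gt0.
    rewrite /wgt -invfM -exprD -/(wgt _) -/(wgt _) ler_wgt //; lia.
  rewrite pair_big_dep /= sumr_const.
  apply: (@le_trans _ _ (wgt w *+ (lam * (#|N| + #|far|)))).
    rewrite ler_pMn2l ?wgt_gt0 //; apply: leq_trans (dens N far).
    rewrite subset_leq_card //; apply/fintype.subsetP => -[u v].
    rewrite unfold_in /= => /and3P[uN uv vfar].
    by rewrite finset.in_setI uv finset.in_setX uN vfar.
  rewrite -mulr_natl natrM mulrAC.
  apply: ler_pM => //; rewrite ?mulr_ge0 // ?(ltW (wgt_gt0 _)) //.
  rewrite natrD lerD2l -natr_sum ler_nat.
  apply: (@leq_trans #|low|).
    apply/subset_leq_card/fintype.subsetP => v; rewrite !inE; lia.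
  by rewrite -sum1_card leq_sum.
have cost_N : #|N|%:R =
   \sum_(u in N) \sum_(v | ((u, v) \in E) && (v \notin far)) wgt (f v) / lwt f u
   + \sum_(u in N) \sum_(v | ((u, v) \in E) && (v \in far)) wgt (f v) / lwt f u.
  rewrite (sum_alloc f) => [|u]; last first.
    by rewrite inE => /existsP[v /andP[uv _]]; exists v.
  rewrite -big_split /=; apply: eq_bigr => u _.
  by rewrite (bigID (fun v => v \in far)) /= addrC.
have split_P : \sum_(v | v \notin far) sat f v + \sum_(v in low) sat f v = P + mid i.
  have -> : P = \sum_(v in far) sat f v + \sum_(v | v \notin far) sat f v.
    by rewrite /P (bigID (fun v => v \in far)).
  rewrite [RHS]addrAC [RHS]addrC; congr (_ + _).
  rewrite (bigID (fun v => v \in far)) /=; congr (_ + _); apply: eq_bigl => v.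
    rewrite !inE; lia.
  by rewrite !inE -leqNgt.
rewrite {1}/cost cost_N -split_P mulrDr; lra.
Qed.

End Proportional.

(** * The auction phase *)

Section Auction.
Variables (L R : finType) (C : R -> nat) (k s : nat).
Variables (name : L -> nat) (tk : L -> R -> nat).
Hypothesis C_gt0 : forall v, (0 < C v)%N.
Hypothesis name_inj : injective name.
Hypothesis tk_le : forall u, (\sum_v tk u v <= s)%N.

Variables (acc : nat -> R -> seq nat) (bid : nat -> L -> option R)
  (bidders : nat -> R -> seq nat).

Definition price (t : nat) (v : R) : nat := (size (acc t v) %/ C v)%N.
Definition holders (t : nat) (v : R) : seq nat := drop (size (acc t v) - C v) (acc t v).
Definition held (t : nat) (u : L) : bool := [exists v, name u \in holders t v].
Definition matching (t : nat) : {set L * R} := [set x | name x.1 \in holders t x.2].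

Hypothesis acc0 : forall v, acc 0 v = [::].
(** The truncation stops the list at the next multiple of [C v], so all bids accepted in one round
    are accepted at the same price. *)
Hypothesis accS : forall t v,
  acc t.+1 v = acc t v ++ take (C v - size (acc t v) %% C v) (bidders t v).
Hypothesis bid_some : forall t u v, bid t u = Some v ->
  [/\ ~~ held t u, (0 < tk u v)%N, (price t v < k)%N
    & forall v', (0 < tk u v')%N -> (price t v <= price t v')%N].
Hypothesis bid_none : forall t u, bid t u = None ->
  held t u \/ forall v, (0 < tk u v)%N -> (k <= price t v)%N.
Hypothesis bidders_uniq : forall t v, uniq (bidders t v).
Hypothesis biddersP : forall t v u, (name u \in bidders t v) = (bid t u == Some v).
Hypothesis bidders_name : forall t v i, i \in bidders t v -> exists u, i = name u.

Let taken t v := take (C v - size (acc t v) %% C v) (bidders t v).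

Lemma size_taken t v : (size (taken t v) <= C v - size (acc t v) %% C v)%N.
Proof. by rewrite /taken size_take_min geq_minl. Qed.

Lemma price_le t v : (price t v <= price t.+1 v)%N.
Proof. by rewrite /price accS size_cat leq_div2r // leq_addr. Qed.

Lemma bidders_price t v : bidders t v != [::] -> (price t v < k)%N.
Proof.
case E: (bidders t v) => [//|i b] _.
have iin : i \in bidders t v by rewrite E mem_head.
have [u iu] := bidders_name iin; move: iin; rewrite iu biddersP => /eqP.
by case/bid_some.
Qed.

(** Bids are placed only at prices below [k], and one round never passes the next multiple of
    [C v]. *)
Lemma acc_le t v : (size (acc t v) <= k * C v)%N.
Proof.
elim: t => [|t IH]; first by rewrite acc0.
rewrite accS size_cat -/(taken t v).
have [E|/bidders_price pk] := eqVneq (bidders t v) [::].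
  by rewrite /taken E /= addn0.
apply: (@leq_trans ((price t v).+1 * C v)%N); last by rewrite leq_mul2r pk orbT.
rewrite mulSn addnC; apply: (leq_trans (leq_add (size_taken t v) (leqnn _))).
rewrite {2}(divn_eq (size (acc t v)) (C v)) /price.
by have := ltn_pmod (size (acc t v)) (C_gt0 v); lia.
Qed.

(** The quotient of [i] by [C v] is the price at which this bid was accepted. It was then the lowest
    price among the tokens of [u], and prices never decrease. *)
Lemma acc_nth t v i u : (i < size (acc t v))%N -> nth 0%N (acc t v) i = name u ->
  (0 < tk u v)%N /\ forall v', (0 < tk u v')%N -> (i %/ C v <= price t v')%N.
Proof.
elim: t => [|t IH]; first by rewrite acc0.
rewrite accS size_cat nth_cat -/(taken t v); case: ifP => [lt_i _ /(IH lt_i)[tuv le_p]|].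
  by split=> // v' /le_p/leq_trans; apply; exact: price_le.
move/negbT; rewrite -leqNgt => le_i lt_i nth_i.
have /mem_take : name u \in taken t v by rewrite -nth_i mem_nth // ltn_subLR.
rewrite biddersP => /eqP /bid_some [_ tuv _ min_p]; split=> // v' /min_p le_p.
apply: leq_trans (price_le t v'); apply: leq_trans le_p.
rewrite -ltnS ltn_divLR //.
have eq_size := divn_eq (size (acc t v)) (C v).
have := size_taken t v; have := ltn_pmod (size (acc t v)) (C_gt0 v).
rewrite mulSn -/(price t v) in eq_size *; lia.
Qed.

(** At most [C v] bids are accepted in a round, so all of them are kept and only the oldest holders
    are evicted. *)
Lemma holdersS t v : exists j, holders t.+1 v = drop j (holders t v) ++ taken t v.
Proof.
exists (size (taken t v) - (C v - size (acc t v)))%N; rewrite /holders accS size_cat -/(taken t v).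
have sC : (size (taken t v) <= C v)%N by apply: (leq_trans (size_taken t v)); apply: leq_subr.
rewrite drop_cat drop_drop; case: ltnP => [_|le].
  by congr (drop _ _ ++ _); lia.
have -> : (size (acc t v) + size (taken t v) - C v - size (acc t v) = 0)%N by lia.
by rewrite drop0 drop_oversize //; lia.
Qed.

Lemma mem_holdersS t v i : i \in holders t.+1 v -> (i \in holders t v) || (i \in taken t v).
Proof.
have [j ->] := holdersS t v.
by rewrite mem_cat => /orP[/mem_drop->|->]; rewrite ?orbT.
Qed.

Lemma taken_free t v u : name u \in taken t v -> bid t u = Some v /\ ~~ held t u.
Proof. by move/mem_take; rewrite biddersP => /eqP /[dup] /bid_some[]. Qed.

Lemma holders_uniq t v : uniq (holders t v).
Proof.
elim: t => [|t IH]; first by rewrite /holders acc0.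
have [j ->] := holdersS t v; rewrite cat_uniq drop_uniq //= take_uniq // andbT.
apply/hasPn => i iin; have [u iu] := bidders_name (mem_take iin).
rewrite iu in iin *; have [_] := taken_free iin; rewrite negb_exists => /forallP/(_ v).
by apply: contra; apply: mem_drop.
Qed.

(** Only a free vertex bids, and for a single [v] per round. *)
Lemma held_unique t u v v' :
  name u \in holders t v -> name u \in holders t v' -> v = v'.
Proof.
elim: t => [|t IH]; first by rewrite /holders acc0.
move=> /mem_holdersS /orP[uv|/taken_free[uv free]] /mem_holdersS /orP[uv'|/taken_free[uv' free']].
- exact: IH.
- by case/negP: free'; apply/existsP; exists v.
- by case/negP: free; apply/existsP; exists v'.
- by move: uv'; rewrite uv => -[].
Qed.

Lemma holders_name t v i : i \in holders t v -> exists u, i = name u.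
Proof.
elim: t => [|t IH]; first by rewrite /holders acc0.
by move=> /mem_holdersS /orP[/IH //|/mem_take /bidders_name].
Qed.

Lemma card_name (b : seq nat) : (#|[set u | name u \in b]| <= size b)%N.
Proof.
rewrite cardE -(size_map name); apply: uniq_leq_size; first by rewrite map_inj_uniq ?enum_uniq.
by move=> i /mapP[u]; rewrite mem_enum inE => ? ->.
Qed.

Lemma card_name_uniq (b : seq nat) : uniq b -> (forall i, i \in b -> exists u, i = name u) ->
  #|[set u | name u \in b]| = size b.
Proof.
move=> ub nb; apply/eqP; rewrite eqn_leq card_name /=.
rewrite cardE -(size_map name); apply: uniq_leq_size => // i ib.
have [u iu] := nb i ib; apply/mapP; exists u => //.
by rewrite mem_enum inE -iu.
Qed.

Lemma matching_tk t u v : (u, v) \in matching t -> (0 < tk u v)%N.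
Proof.
rewrite inE /= => /mem_drop /(nthP 0%N)[i lt_i nth_i].
by have [] := acc_nth lt_i nth_i.
Qed.

Lemma matching_left t u : (#|[set x in matching t | x.1 == u]| <= 1)%N.
Proof.
apply/card_le1_eqP => -[u1 v1] [u2 v2]; rewrite !inE /= => /andP[h1 /eqP e1] /andP[h2 /eqP e2].
by rewrite e1 e2 in h1 h2 *; rewrite (held_unique h1 h2).
Qed.

Lemma card_matching_right t v : #|[set x in matching t | x.2 == v]| = minn (size (acc t v)) (C v).
Proof.
have -> : [set x in matching t | x.2 == v] = [set (u, v) | u in [set u | name u \in holders t v]].
  apply/setP => -[u v']; rewrite !inE /=; apply/andP/imsetP => [[h /eqP e]|[u']].
    by exists u; rewrite ?inE ?e // -e.
  by rewrite inE => h [-> ->].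
rewrite card_imset; last by move=> ? ? [].
rewrite card_name_uniq ?holders_uniq //; last by move=> i; apply: holders_name.
rewrite size_drop; lia.
Qed.

Lemma card_matching t : #|matching t| = (\sum_v minn (size (acc t v)) (C v))%N.
Proof.
rewrite -sum1_card (partition_big (fun x => x.2) xpredT) //=; apply: eq_bigr => v _.
rewrite -card_matching_right sum1_card; apply: eq_card => x; by rewrite [RHS]inE unfold_in.
Qed.

Lemma card_matching_mono t t' : (t <= t')%N -> (#|matching t| <= #|matching t'|)%N.
Proof.
move=> /subnKC <-; elim: (t' - t)%N => [|n IH]; first by rewrite addn0.
rewrite addnS (leq_trans IH) // !card_matching; apply: leq_sum => v _.
rewrite accS size_cat; lia.
Qed.

Let load v := (\sum_u tk u v)%N.
Let over := (\sum_v (load v - s * C v))%N.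
Let bids t := #|[set u | bid t u != None]|.

Lemma size_bidders t v : size (bidders t v) = #|[set u | bid t u == Some v]|.
Proof.
rewrite -card_name_uniq //; last by move=> i; apply: bidders_name.
by apply: eq_card => u; rewrite !inE biddersP.
Qed.

Lemma size_bidders_load t v : (size (bidders t v) <= load v)%N.
Proof.
rewrite size_bidders -sum1_card /load [X in (X <= _)%N]big_mkcond /=.
apply: leq_sum => u _; rewrite inE; case: eqP => // /bid_some[] //.
Qed.

Lemma bids_sum t : bids t = (\sum_v size (bidders t v))%N.
Proof.
rewrite /bids -sum1_card (eq_bigr _ (fun v _ => size_bidders t v)).
under [RHS]eq_bigr do rewrite -sum1_card big_mkcond.
rewrite exchange_big big_mkcond /=; apply: eq_bigr => u _; rewrite !inE.
case E: (bid t u) => [v|]; last by rewrite big1 // => v _; rewrite inE E.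
rewrite (bigD1 v) //= inE E eqxx big1 ?addn0 // => v' ne.
by rewrite inE E; case: eqP => // -[vv']; rewrite vv' eqxx in ne.
Qed.

(* A round in which not all bids are accepted raises the price. *)
Lemma bids_potential t v :
  (\sum_(i < t) size (bidders i v) <= size (acc t v) + load v * price t v)%N.
Proof.
elim: t => [|t IH]; first by rewrite big_ord0.
rewrite big_ord_recr /= accS size_cat -/(taken t v).
have [all_in|cut] := leqP (size (bidders t v)) (C v - size (acc t v) %% C v).
  have -> : taken t v = bidders t v by rewrite /taken take_oversize.
  by rewrite addnAC leq_add2r (leq_trans IH) // leq_add2l leq_mul2l price_le orbT.
have -> : price t.+1 v = (price t v).+1.
  rewrite /price accS size_cat -/(taken t v) /taken size_takel 1?ltnW //.
  rewrite {1}(divn_eq (size (acc t v)) (C v)) -addnA subnKC; last by rewrite ltnW ?ltn_pmod.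
  by rewrite divnMDl // divnn C_gt0 addn1.
rewrite mulnS [(load v + _)%N]addnC addnA leq_add ?size_bidders_load //.
by rewrite (leq_trans IH) // leq_add2r leq_addr.
Qed.

Hypothesis k_gt0 : (0 < k)%N.

(** If [v] has accepted fewer than [C v] bids, its price is 0 and all these bids are held. Otherwise
    it contributes [C v] to the matching, and its load is at most [s * C v] plus its excess. *)
Lemma bids_total t :
  (\sum_(i < t) bids i <= k * (1 + s) * #|matching t| + k * over)%N.
Proof.
under eq_bigr do rewrite bids_sum.
rewrite exchange_big card_matching /over !big_distrr -big_split /=.
apply: leq_sum => v _; apply: (leq_trans (bids_potential t v)).
have le_k : (price t v <= k)%N.
  by rewrite -(mulnK k (C_gt0 v)) leq_div2r // acc_le.
rewrite mulnDr muln1 mulnDl -addnA; apply: leq_add.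
  by case: (leqP (size (acc t v)) (C v)) => _; rewrite ?acc_le ?leq_pmull.
have [lt|ge] := ltnP (size (acc t v)) (C v); first by rewrite /price divn_small // muln0.
rewrite -mulnA -mulnDr mulnC; apply: leq_mul => //; lia.
Qed.

(** For [th > 0]: when the price of [v] has reached [th], the number of its current holders whose
    bid was accepted at a price below [th]. *)
Let extra th t v :=
  (if (th * C v <= size (acc t v))%N then th * C v + C v - size (acc t v) else 0)%N.

(** At most one threshold gives a nonzero term, and then [v] has [C v] holders. *)
Lemma extra_sum t v :
  (\sum_(i < k) extra i.+1 t v <= minn (size (acc t v)) (C v))%N.
Proof.
have [[i0 i0P]|none] := pselect (exists i : 'I_k,
    (i.+1 * C v <= size (acc t v) < i.+1 * C v + C v)%N).
  rewrite (bigD1 i0) //= big1 ?addn0 => [|i ne]; rewrite /extra; first by case: ifP; nia.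
  case: ifP => // le; apply/eqP; rewrite subn_eq0 leqNgt; apply/negP => lt.
  by case/eqP: ne; apply: val_inj => /=; nia.
rewrite big1 // => i _; rewrite /extra; case: ifP => // le; apply/eqP; rewrite subn_eq0 leqNgt.
by apply/negP => lt; case: none; exists i; rewrite le.
Qed.

(** Every token has its left end in [A] or its right end at a price of at least [th]. A vertex of
    [A] that does not bid is held, and by [acc_nth] its bid is among the first [th * C v0] ones of
    its holder [v0]. Such holders make up [old]; together with the capacities at price at least [th]
    they amount to the matching plus [extra]. *)
Lemma load_cover t th : (th <= k)%N ->
  (\sum_v load v <= over + s * (#|matching t| + \sum_v extra th t v + bids t))%N.
Proof.
move=> th_k.
pose A := [set u | [exists v, (0 < tk u v)%N && (price t v < th)%N]].
pose old v := drop (size (acc t v) - C v) (take (th * C v) (acc t v)).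
have cardA : (#|A| <= bids t + \sum_v size (old v))%N.
  have : A \subset [set u | bid t u != None] :|: \bigcup_v [set u | name u \in old v].
    apply/fintype.subsetP => u; rewrite !inE => /existsP[v /andP[tuv lt_p]].
    case E: (bid t u) => [//|] /=; case: (bid_none E) => [/existsP[v0]|/(_ v tuv)]; last by lia.
    move=> /(nthP 0%N)[i]; rewrite size_drop nth_drop => lt_i nth_i.
    apply/bigcupP; exists v0 => //; rewrite inE.
    have lt_i' : (size (acc t v0) - C v0 + i < size (acc t v0))%N. by rewrite -ltn_subRL.
    have [_ /(_ v tuv) le_p] := acc_nth lt_i' nth_i.
    have : (size (acc t v0) - C v0 + i < th * C v0)%N by rewrite -ltn_divLR // (leq_ltn_trans le_p).
    move=> lt_th; rewrite -nth_i -(nth_take 0%N lt_th) -nth_drop mem_nth //.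
    by rewrite size_drop size_take_min; lia.
  move/subset_leq_card/leq_trans; apply.
  apply: leq_trans (_ : _ <= bids t + #|\bigcup_v [set u | name u \in old v]|)%N _.
    by rewrite /bids -cardsUI leq_addr.
  rewrite leq_add2l; apply: (leq_trans (card_bigcup_leq _ _)).
  by apply: leq_sum => v _; apply: card_name.
have : (\sum_v load v <= s * #|A| + \sum_(v | (th <= price t v)%N) load v)%N.
  rewrite (bigID (fun v => th <= price t v)%N) /= addnC leq_add2r.
  rewrite mulnC -sum_nat_const /load exchange_big /= [X in (_ <= X)%N]big_mkcond /=.
  apply: leq_sum => u _; case: ifP => uA.
    apply: leq_trans (tk_le u).
    by rewrite [X in (_ <= X)%N](bigID (fun v => th <= price t v)%N) /= leq_addl.
  rewrite big1 // => v; rewrite -ltnNge => lt_p; move/negbT: uA; rewrite inE negb_exists.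
  by move=> /forallP/(_ v); rewrite lt_p andbT -eqn0Ngt => /eqP.
move/leq_trans; apply.
apply: (@leq_trans (s * (bids t + \sum_v size (old v)) +
    (s * \sum_(v | (th <= price t v)%N) C v + over))%N).
  apply: leq_add; first by rewrite leq_mul2l cardA orbT.
  rewrite big_distrr /over /= [X in (_ <= _ + X)%N](bigID (fun v => th <= price t v)%N) /=.
  rewrite addnA -big_split /=; apply: (leq_trans _ (leq_addr _ _)).
  by apply: leq_sum => v _; lia.
rewrite addnA addnC leq_add2l -mulnDr leq_mul2l; apply/orP; right.
rewrite -addnA addnC leq_add2r card_matching [X in (_ + X <= _)%N]big_mkcond -!big_split /=.
apply: leq_sum => v _; rewrite size_drop size_take_min /extra [(th <= _)%N]leq_divRL //.
by case: ifP; lia.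
Qed.

(** [load_cover] is summed over the thresholds [1] to [k] and over the [T] rounds. The terms [extra]
    cost one more matching, and [T] is chosen so that, by [bids_total], [k] times the average number
    of bids costs another one, up to a term in [over]. *)
Lemma auction_value (T := (k * k * (1 + s))%N) :
  (k * \sum_v load v <= s * (k + 2) * #|matching T| + 2 * k * over)%N.
Proof.
have step t : (t <= T)%N -> (k * \sum_v load v <=
    k * over + s * (k.+1 * #|matching T| + k * bids t))%N.
  move=> /card_matching_mono mono.
  have : (\sum_(i < k) \sum_v load v <=
      \sum_(i < k) (over + s * (#|matching t| + \sum_v extra i.+1 t v + bids t)))%N.
    by apply: leq_sum => i _; apply: load_cover.
  rewrite sum_nat_const card_ord => /leq_trans; apply.
  rewrite big_split sum_nat_const card_ord /= leq_add2l -big_distrr leq_mul2l /=.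
  apply/orP; right; rewrite !big_split !sum_nat_const card_ord /= leq_add2r.
  rewrite mulSn addnC exchange_big /=; apply: leq_add; last by rewrite leq_mul2l mono orbT.
  apply: leq_trans mono; rewrite card_matching; apply: leq_sum => v _; exact: extra_sum.
have : (\sum_(t < T) k * \sum_v load v <=
    \sum_(t < T) (k * over + s * (k.+1 * #|matching T| + k * bids t)))%N.
  by apply: leq_sum => t _; apply: step; apply: ltnW.
rewrite sum_nat_const card_ord big_split sum_nat_const card_ord /=.
rewrite -big_distrr /= big_split sum_nat_const card_ord -big_distrr /= => sum_le.
have := bids_total T; set bs := (\sum_(t < T) bids t)%N in sum_le * => le_bs.
have T_gt0 : (0 < T)%N by rewrite /T !muln_gt0 k_gt0.
rewrite -(leq_pmul2l T_gt0); apply: (leq_trans sum_le) => {sum_le}.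
have : (s * (k * bs) <= s * (k * (k * (1 + s) * #|matching T| + k * over)))%N.
  by rewrite !leq_mul2l le_bs !orbT.
have : (T * over <= T * (k * over))%N by rewrite leq_mul2l leq_pmull ?orbT.
have : (s * (k * (k * over)) <= T * over)%N.
  by rewrite !mulnA leq_mul2r /T -mulnA mulnC leq_mul2l leqnSn !orbT.
move: #|matching T| over @bs le_bs => m z b _.
rewrite /T; lia.
Qed.

End Auction.

(** * Uniform means over cubes of coins *)

Section UniformMean.
Variables (K : realType) (Om : finType).
Hypothesis Om_gt0 : (0 < #|Om|)%N.

Definition mean (F : Om -> K) : K := (\sum_w F w) / #|Om|%:R.

Let cardOm_gt0 : 0 < #|Om|%:R :> K. Proof. by rewrite ltr0n. Qed.

Lemma mean_sum (I : finType) (P : pred I) (F : I -> Om -> K) :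
  mean (fun w => \sum_(i | P i) F i w) = \sum_(i | P i) mean (F i).
Proof. by rewrite /mean exchange_big mulr_suml. Qed.

Lemma mean_cst (c : K) : mean (fun=> c) = c.
Proof. by rewrite /mean sumr_const -[_ *+ _]mulr_natr mulfK // gt_eqF. Qed.

Lemma meanD F G : mean (fun w => F w + G w) = mean F + mean G.
Proof. by rewrite /mean big_split mulrDl. Qed.

Lemma meanZ c F : mean (fun w => c * F w) = c * mean F.
Proof. by rewrite /mean -mulr_sumr mulrA. Qed.

Lemma le_mean F G : (forall w, F w <= G w) -> mean F <= mean G.
Proof. by move=> FG; rewrite ler_pM2r ?invr_gt0 // ler_sum. Qed.

Lemma eq_mean F G : F =1 G -> mean F = mean G.
Proof. by move=> FG; rewrite /mean; congr (_ / _); apply: eq_bigr. Qed.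

(* Chebyshev: [4 (c - mu) (N - c) <= (N - mu)^2] because the difference is the
   square [(N - mu - 2 (c - mu))^2]. *)
Lemma mean_excess (I : finType) (X : I -> Om -> bool) (p : I -> K) (c : nat) (e : K) :
  0 < e ->
  (forall i, mean (fun w => (X i w)%:R) = p i) ->
  (forall i j, i != j -> mean (fun w => (X i w)%:R * (X j w)%:R) = p i * p j) ->
  \sum_i p i <= (1 - e) * c%:R ->
  4 * e * c%:R * mean (fun w => (\sum_i X i w - c)%:R) <= \sum_i p i.
Proof.
move=> e0 meanX meanXX mu_le; set mu := \sum_i p i in mu_le *.
have p_ge0 i : 0 <= p i.
  by rewrite -meanX -(mean_cst 0); apply: le_mean => w; rewrite ler0n.
have mu_ge0 : 0 <= mu by apply: sumr_ge0.
(* Pairwise independence cancels the cross terms; each diagonal term is [p i * (1 - p i)]. *)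
have var : mean (fun w => (\sum_i ((X i w)%:R - p i)) ^+ 2) <= mu.
  have -> : mean (fun w => (\sum_i ((X i w)%:R - p i)) ^+ 2) =
      \sum_i \sum_j mean (fun w => ((X i w)%:R - p i) * ((X j w)%:R - p j)).
    under [RHS]eq_bigr do rewrite -mean_sum.
    rewrite -mean_sum; apply: eq_mean => w; rewrite expr2 big_distrlr /=.
    by [].
  apply: ler_sum => i _; rewrite (bigD1 i) //= big1 ?addr0 => [|j ij].
    have -> : mean (fun w => ((X i w)%:R - p i) * ((X i w)%:R - p i)) =
        mean (fun w => (1 - 2 * p i) * (X i w)%:R + p i * p i).
      by apply: eq_mean => w; case: (X i w) => /=; ring.
    rewrite meanD mean_cst meanZ meanX.
    have := p_ge0 i; nra.
  have -> : mean (fun w => ((X i w)%:R - p i) * ((X j w)%:R - p j)) =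
      mean (fun w => ((X i w)%:R * (X j w)%:R + - p i * (X j w)%:R) +
                     (- p j * (X i w)%:R + p i * p j)).
    by apply: eq_mean => w; ring.
  by rewrite !meanD mean_cst !meanZ !meanX meanXX 1?eq_sym //; ring.
apply: le_trans var; rewrite -meanZ; apply: le_mean => w.
rewrite sumrB -natr_sum -/mu; set N := (\sum_i X i w)%N.
have [le|lt] := leqP N c.
  by move: le; rewrite -subn_eq0 => /eqP ->; rewrite mulr0 sqr_ge0.
rewrite natrB ?(ltnW lt) //.
have Nc : 0 <= N%:R - c%:R :> K by rewrite subr_ge0 ler_nat ltnW.
apply: (@le_trans _ _ (4 * (c%:R - mu) * (N%:R - c%:R))).
  rewrite ler_wpM2r // -mulrA ler_pM2l //; lra.
have := sqr_ge0 (N%:R - mu - 2 * (c%:R - mu)); nra.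
Qed.

End UniformMean.

Section Cube.
Variables (K : realType) (I : finType).
Local Notation cube := {ffun I -> bool}.

Lemma cube_gt0 : (0 < #|{: cube}|)%N.
Proof. by apply/card_gt0P; exists [ffun=> false]. Qed.

Definition depends_on (Y : Type) (S : pred I) (F : cube -> Y) :=
  forall b b' : cube, (forall i, S i -> b i = b' i) -> F b = F b'.

(* Exchanging the coordinates in [S] of two independent points is measure
   preserving. *)
Lemma mean_indep (S S' : pred I) (F F' : cube -> K) :
  (forall i, S i -> S' i -> False) -> depends_on S F -> depends_on S' F' ->
  mean (fun b => F b * F' b) = mean F * mean F'.
Proof.
move=> SS' FS FS'; rewrite /mean.
have card_neq0 : #|{: cube}|%:R != 0 :> K by rewrite pnatr_eq0 -lt0n cube_gt0.
pose mix (x : cube * cube) : cube * cube :=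
  ([ffun i => if S i then x.1 i else x.2 i], [ffun i => if S i then x.2 i else x.1 i]).
have mixK : involutive mix.
  by case=> b b'; congr pair; apply/ffunP => i; rewrite !ffunE /=; case: (S i).
suff : (\sum_b F b * F' b) * #|{: cube}|%:R = (\sum_b F b) * (\sum_b F' b).
  by move=> eq; rewrite mulf_div -eq invfM mulrA mulfK.
rewrite big_distrlr /= pair_big /= (reindex_inj (inv_inj mixK)) /=.
rewrite mulr_suml -(pair_bigA _ (fun b b' : cube =>
  F [ffun i => if S i then b i else b' i] *
  F' [ffun i => if S i then b' i else b i])) /=.
apply: eq_bigr => b _; rewrite mulr_natr -sumr_const; apply: eq_bigr => b' _; congr (_ * _).
  by apply: FS => i Si; rewrite ffunE Si.
by apply: FS' => i Si; rewrite ffunE; case: ifP => // S_i; case: (SS' i).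
Qed.

(** All fibres of the restriction have the same size: flipping the coordinates where [a] and [a']
    differ exchanges their fibres. *)
Lemma mean_restrict (m : nat) (pos : 'I_m -> I) (h : {ffun 'I_m -> bool} -> K) :
  injective pos ->
  mean (fun b : cube => h [ffun i => b (pos i)]) = (\sum_a h a) / (2 ^ m)%:R.
Proof.
move=> pos_inj; pose r (b : cube) : {ffun 'I_m -> bool} := [ffun i => b (pos i)].
pose fib a := #|[set b | r b == a]|.
have fib_cst a a' : (fib a <= fib a')%N.
  pose d (i : I) := [exists j, (pos j == i) && (a j != a' j)].
  pose flip (b : cube) : cube := [ffun i => b i (+) d i].
  have flipK : involutive flip by move=> b; apply/ffunP => i; rewrite !ffunE addbK.
  rewrite /fib -(card_imset [set b | r b == a] (inv_inj flipK)); apply: subset_leq_card.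
  apply/fintype.subsetP => _ /imsetP[b + ->]; rewrite !inE => /eqP rb.
  apply/eqP/ffunP => j; rewrite !ffunE.
  have -> : b (pos j) = a j by rewrite -rb ffunE.
  have -> : d (pos j) = (a j != a' j).
    apply/existsP/idP => [[j' /andP[/eqP/pos_inj -> //]]|ne]; exists j.
    by rewrite eqxx.
  by case: (a j); case: (a' j).
have fibE a : fib a = fib [ffun=> false] by apply/eqP; rewrite eqn_leq !fib_cst.
set c := fib _ in fibE.
have sumE (g : {ffun 'I_m -> bool} -> K) : \sum_b g (r b) = (\sum_a g a) * c%:R.
  rewrite (partition_big r xpredT) //= mulr_suml; apply: eq_bigr => a _.
  rewrite -(fibE a) mulr_natr /fib -sumr_const.
  by apply: eq_big => [b|b /eqP -> //]; rewrite inE.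
have cardE : #|{: cube}|%:R = (2 ^ m)%:R * c%:R :> K.
  have := sumE (fun=> 1); rewrite !sumr_const => ->; congr (_ * _).
  by rewrite card_ffun card_bool card_ord.
rewrite /mean sumE cardE invfM mulrACA divff ?mulr1 //.
have := cube_gt0; rewrite -(ltr_nat K) cardE; apply: contraTneq => ->.
by rewrite mulr0 ltxx.
Qed.

End Cube.

(** * Drawing tokens *)

Section Tokens.
Variables (K : realType) (e : K) (s : nat).
Hypotheses (e_gt0 : 0 < e).

Implicit Type l : seq (nat * K).

(* The probabilities in [l] are rounded down to multiples of [2 ^- precision l],
   which loses at most a fraction [e] of each. *)
Definition precision l : nat := (\max_(x <- l) (Num.truncn (e * x.2)^-1).+1)%N.
Definition weight l (x : K) : nat := Num.truncn (x * (2 ^ precision l)%:R).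
(** A draw picks one of [2 ^ precision l] equally likely slots; the slots past the end of the table
    give no token. *)
Definition table l : seq nat := flatten [seq nseq (weight l x.2) x.1 | x <- l].
(* The draws are independent because the [j]-th one only reads the coins whose
   index is congruent to [j] modulo [s]. *)
Definition draw l (c : nat -> bool) (j : nat) : option nat :=
  onth (table l)
    (enum_rank [ffun i : 'I_(precision l) => c (i * s + j)%N]).
Definition tokens l (c : nat -> bool) : seq nat := pmap (draw l c) (iota 0 s).

Lemma weight_le l x : 0 <= x -> (weight l x)%:R <= x * (2 ^ precision l)%:R.
Proof. by move=> x0; rewrite Num.Theory.truncn_le mulr_ge0. Qed.

(** The precision makes [e * y] at least 1, so rounding [y] down loses at most [e * y]. *)
Lemma weight_ge l i x : (i, x) \in l -> 0 < x ->
  (1 - e) * (x * (2 ^ precision l)%:R) <= (weight l x)%:R.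
Proof.
move=> ixl x0; set y := x * _.
have : 1 <= e * y.
  rewrite /y mulrA -ler_pdivrMl ?mulr_gt0 // mulr1.
  apply: (@le_trans _ _ (Num.truncn (e * x)^-1).+1%:R).
    by rewrite ltW // Num.Theory.truncnS_gt.
  rewrite ler_nat; apply: (@leq_trans (precision l)); last by rewrite ltnW // ltn_expl.
  by rewrite /precision (big_rem _ ixl) /= leq_max leqnn.
have : y < (weight l x).+1%:R by rewrite Num.Theory.truncnS_gt.
rewrite -natr1; lra.
Qed.

Lemma size_table l : (forall x, x \in l -> 0 <= x.2) -> \sum_(x <- l) x.2 <= 1 ->
  (size (table l) <= 2 ^ precision l)%N.
Proof.
move=> l0 l1; rewrite /table size_flatten /shape -map_comp sumnE big_map.
rewrite -(ler_nat K) natr_sum big_seq.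
apply: (@le_trans _ _ (\sum_(x <- l | x \in l) x.2 * (2 ^ precision l)%:R)).
  by apply: ler_sum => x xl; rewrite /= size_nseq weight_le ?l0.
by rewrite -big_seq -mulr_suml ler_piMl.
Qed.

Lemma count_table l i x : uniq [seq x.1 | x <- l] -> (i, x) \in l ->
  count_mem i (table l) = weight l x.
Proof.
move=> ul ixl; rewrite /table count_flatten sumnE !big_map (big_rem _ ixl) /=.
rewrite count_nseq /= eqxx mul1n big_seq big1 ?addn0 // => -[i' x'] ix'.
rewrite count_nseq /=; case: eqP => // ii'; rewrite ii' in ix'.
have /perm_to_rem/(perm_map (fun x => x.1))/perm_uniq := ixl.
by rewrite ul /= => /esym/andP[/negP[]]; apply/mapP; exists (i, x').
Qed.

Lemma draw_name l c j i : draw l c j = Some i -> i \in [seq x.1 | x <- l].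
Proof.
rewrite /draw => ontht; have /flattenP[_ /mapP[[i' x] ixl ->]] : i \in table l.
  by apply/onthP; eexists; exact: ontht.
by move=> /nseqP[-> _]; apply/mapP; exists (i', x).
Qed.

(** Ranking identifies the coin words with the slots below [2 ^ m], and those outside [T] yield
    [None]. *)
Lemma sum_count_onth (T : seq nat) (m : nat) (i : nat) : (size T <= 2 ^ m)%N ->
  (\sum_(a : {ffun 'I_m -> bool}) (onth T (enum_rank a) == Some i) = count_mem i T)%N.
Proof.
move=> sT.
have card_m : #|{: {ffun 'I_m -> bool}}| = (2 ^ m)%N by rewrite card_ffun card_bool card_ord.
rewrite (reindex _ (onW_bij _ (@enum_val_bij {ffun 'I_m -> bool}))) /=.
under eq_bigr do rewrite enum_valK.
rewrite -(big_mkord xpredT (fun r => onth T r == Some i : nat)) card_m.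
rewrite (big_cat_nat (leq0n _) sT) /= [X in (_ + X)%N = _](_ : _ = 0%N); last first.
  by rewrite big_nat_cond big1 // => r /andP[/andP[Tr _] _]; rewrite onth_default.
rewrite addn0 -sum1_count [RHS]big_mkcond [RHS](big_nth 0%N) /=.
apply: eq_big_nat => r /andP[_ rT].
by rewrite onthE (nth_map 0%N) // (inj_eq Some_inj) /=; case: eqP.
Qed.

Lemma count_tokens l c i :
  count_mem i (tokens l c) = (\sum_(j < s) (draw l c j == Some i))%N.
Proof.
rewrite /tokens -(big_mkord xpredT (fun j => draw l c j == Some i : nat)) /index_iota subn0.
elim: (iota 0 s) => [|j js IH]; first by rewrite big_nil.
rewrite big_cons -IH /=; case: (draw l c j) => [i'|] //=.
Qed.

Lemma size_tokens l c : (size (tokens l c) <= s)%N.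
Proof. by rewrite size_pmap (leq_trans (count_size _ _)) // size_iota. Qed.

End Tokens.

(** * The LOCAL program *)

Section Program.
Variables (K : realType) (e : K) (s k : nat).

(* [st_weight] is the total weight of the neighbourhood for a vertex of the left
   part, and the scaling factor of the sampling phase for one of the right part. *)
Record vstate := VState {
  st_id : nat;
  st_cap : option nat;
  st_coins : nat -> bool;
  st_level : nat;
  st_weight : K;
  st_tokens : seq nat;
  st_bid : option nat;
  st_accepted : seq nat;
  st_match : seq nat }.

Definition inbox_type := seq (nat * vstate).
Definition step := vstate -> inbox_type -> vstate.

Definition st_price (x : vstate) : nat := (size (st_accepted x) %/ odflt 0 (st_cap x))%N.
Definition st_holders (x : vstate) : seq nat :=
  drop (size (st_accepted x) - odflt 0 (st_cap x)) (st_accepted x).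

Definition set_coins c x := VState (st_id x) (st_cap x) c (st_level x) (st_weight x)
  (st_tokens x) (st_bid x) (st_accepted x) (st_match x).
Definition set_level l x := VState (st_id x) (st_cap x) (st_coins x) l (st_weight x)
  (st_tokens x) (st_bid x) (st_accepted x) (st_match x).
Definition set_weight w x := VState (st_id x) (st_cap x) (st_coins x) (st_level x) w
  (st_tokens x) (st_bid x) (st_accepted x) (st_match x).
Definition set_tokens r x := VState (st_id x) (st_cap x) (st_coins x) (st_level x)
  (st_weight x) r (st_bid x) (st_accepted x) (st_match x).
Definition set_bid b x := VState (st_id x) (st_cap x) (st_coins x) (st_level x)
  (st_weight x) (st_tokens x) b (st_accepted x) (st_match x).
Definition set_accepted a x := VState (st_id x) (st_cap x) (st_coins x) (st_level x)
  (st_weight x) (st_tokens x) (st_bid x) a (st_match x).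
Definition set_match r x := VState (st_id x) (st_cap x) (st_coins x) (st_level x)
  (st_weight x) (st_tokens x) (st_bid x) (st_accepted x) r.

Definition in_alloc (x : vstate) (m : inbox_type) : K :=
  \sum_(y <- m) wgt e (st_level x) / st_weight y.2.

Definition step_weight : step := fun x m =>
  if st_cap x is None then set_weight (\sum_(y <- m) wgt e (st_level y.2)) x else x.
Definition step_level : step := fun x m =>
  if st_cap x is Some c then
    if c%:R < in_alloc x m then set_level (st_level x).+1 x else x
  else x.
(** The factor lowers the received amount to [(1 - e) * c] when it is larger; the slack [e * c] is
    what Chebyshev's inequality needs. *)
Definition step_scale : step := fun x m =>
  if st_cap x is Some c then
    set_weight (Num.min 1 ((1 - e) * c%:R / in_alloc x m)) x
  else x.
(* The coins are erased, so that from here on the states depend on them only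
   through the tokens. *)
Definition step_tokens : step := fun x m =>
  set_coins (fun=> false)
    (if st_cap x is None then
       set_tokens (tokens e s
         [seq (y.1, wgt e (st_level y.2) / st_weight x * st_weight y.2) | y <- m]
         (st_coins x)) x
     else x).
Definition step_bid : step := fun x m =>
  if st_cap x is None then
    set_bid
      (if has (fun y => st_id x \in st_holders y.2) m then None
       else omap snd (ohead (sort (relpre fst leq)
         [seq (st_price y.2, y.1) | y <- m & (y.1 \in st_tokens x) && (st_price y.2 < k)%N])))
      x
  else x.
Definition step_accept : step := fun x m =>
  if st_cap x is Some c then
    set_accepted (st_accepted x ++ take (c - size (st_accepted x) %% c)
      [seq y.1 | y <- m & st_bid y.2 == Some (st_id x)]) x
  else x.
Definition step_match : step := fun x m =>
  if st_cap x is None then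
    set_match [seq y.1 | y <- m & st_id x \in st_holders y.2] x
  else x.

(** The weights are recomputed after the last change of levels, so the shares are those of the final
    levels. *)
Definition sampling_program (tau : nat) : seq step :=
  flatten (nseq tau [:: step_weight; step_level])
  ++ [:: step_weight; step_scale; step_tokens].
Definition auction_program (T : nat) : seq step :=
  flatten (nseq T [:: step_bid; step_accept]) ++ [:: step_match].
Definition program tau T := sampling_program tau ++ auction_program T.

Lemma size_program tau T : size (program tau T) = (2 * tau + 2 * T + 4)%N.
Proof.
rewrite !size_cat !size_flatten /shape !map_nseq !sumn_nseq /=; lia.
Qed.

Definition init_state i c w : vstate := VState i c w 0 0 [::] None [::] [::].

(** The state carries the rest of the program, one step of which is consumed per round; every
    message is the whole state of its sender. *)
Definition local_algorithm (tau : nat -> nat) (T : nat) : algorithm :=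
  @Algorithm (seq step * vstate) vstate
    (fun lam i c w => (program (tau lam) T, init_state i c w))
    (fun x _ => x.2)
    (fun x m => (behead x.1, head (fun y _ => y) x.1 x.2 m))
    (fun lam => size (program (tau lam) T))
    (fun x j => if st_cap x.2 is None then j \in st_match x.2 else j \in st_holders x.2).

Section Run.
Variables (G : instance) (id : vertex G -> nat).
Hypothesis id_inj : injective id.
Local Notation L := (lpart G).
Local Notation R := (rpart G).
Local Notation E := (edges G).
Local Notation C := (@cap G).
Local Notation global := (vertex G -> vstate).

Definition received (S : global) (x : vertex G) : inbox_type :=
  [seq (id y, S y) | y <- neighbours id x].
Definition exec (S : global) (f : step) : global := fun x => f (S x) (received S x).
Definition run (p : seq step) (S : global) : global := foldl exec S p.

Lemma run_cat p q S : run (p ++ q) S = run q (run p S).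
Proof. exact: foldl_cat. Qed.

Lemma run_nseq n p S : run (flatten (nseq n p)) S = iter n (run p) S.
Proof. by elim: n S => //= n IH S; rewrite run_cat IH -iterSr. Qed.

Definition init_global (coins : vertex G -> nat -> bool) : global :=
  fun y => init_state (id y) (local_input y) (coins y).

Lemma final_run tau T lam coins x :
  final (local_algorithm tau T) lam id coins x =
  ([::], run (program (tau lam) T) (init_global coins) x).
Proof.
have iter_run p (S : global) :
    iter (size p) (@Defs.round (local_algorithm tau T) G id) (fun y => (p, S y)) =
    (fun y => ([::], run p S y)).
  by elim: p S => [//|g p IH] S; rewrite [size _]/= iterSr -IH; congr iter.
exact: (congr1 (fun F => F x) (iter_run _ _)).
Qed.

Lemma mem_neighbours x y : (y \in neighbours id x) = adj E x y.
Proof. by rewrite mem_sort mem_enum. Qed.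

Lemma neighbours_uniq x : uniq (neighbours id x).
Proof. by rewrite sort_uniq enum_uniq. Qed.

Lemma sum_neighbours x (F : vertex G -> K) :
  \sum_(y <- neighbours id x) F y = \sum_(y | adj E x y) F y.
Proof.
by rewrite (perm_big (enum (adj E x))) ?perm_sort //= big_enum.
Qed.

Lemma sum_neighbours_left u (F : vertex G -> K) :
  \sum_(y <- neighbours id (inl u)) F y = \sum_(v | (u, v) \in E) F (inr v).
Proof. by rewrite sum_neighbours big_sumType /= big_pred0_eq add0r. Qed.

Lemma sum_neighbours_right v (F : vertex G -> K) :
  \sum_(y <- neighbours id (inr v)) F y = \sum_(u | (u, v) \in E) F (inl u).
Proof. by rewrite sum_neighbours big_sumType /= big_pred0_eq addr0. Qed.

(** * Execution of the fractional and sampling phases *)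

Section Sampling.
Variables (coins : vertex G -> nat -> bool) (tau : nat).
Local Notation lev := (level E C e).
Local Notation f := (lev tau).

(** The weight stored on the left lags one round behind the levels and is 0 initially. *)
Definition level_state (t : nat) : global := fun x =>
  match x with
  | inl u => set_weight (if t is t'.+1 then lwt E e (lev t') u else 0) (init_global coins x)
  | inr v => set_level (lev t v) (init_global coins x)
  end.

Lemma exec_weight t : exec (level_state t) step_weight =
  fun x => if x is inl u then set_weight (lwt E e (lev t) u) (init_global coins x)
           else level_state t x.
Proof.
apply/funext => -[u|v] //; rewrite /exec /= /step_weight /=.
by rewrite /received big_map sum_neighbours_left.
Qed.

Lemma in_alloc_weight t v :
  in_alloc (level_state t (inr v)) (received (exec (level_state t) step_weight) (inr v)) =
  alloc E e (lev t) v.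
Proof. by rewrite exec_weight /in_alloc /received big_map sum_neighbours_right. Qed.

Lemma level_stateS t : run [:: step_weight; step_level] (level_state t) = level_state t.+1.
Proof.
apply/funext => -[u|v] /=; first by rewrite {1}/exec exec_weight /step_level /=.
rewrite {1}/exec [exec _ step_weight (inr v)]/= /step_level /=.
have := in_alloc_weight t v; rewrite exec_weight /= => ->.
by rewrite /level_state /level /= /raise; case: ifP.
Qed.

Definition scale (v : R) : K := Num.min 1 ((1 - e) * (C v)%:R / alloc E e f v).
Definition share (u : L) (v : R) : K := wgt e (f v) / lwt E e f u * scale v.
Definition shares (u : L) : seq (nat * K) :=
  [seq (id y, if y is inr v then share u v else 0) | y <- neighbours id (inl u)].

Definition sampled (c : vertex G -> nat -> bool) : global := fun x =>
  match x with
  | inl u => VState (id x) None (fun=> false) 0 (lwt E e f u)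
               (tokens e s (shares u) (c x)) None [::] [::]
  | inr v => VState (id x) (Some (C v)) (fun=> false) (f v) (scale v) [::] None [::] [::]
  end.

Lemma run_sampling : run (sampling_program tau) (init_global coins) = sampled coins.
Proof.
rewrite run_cat run_nseq.
have -> : iter tau (run [:: step_weight; step_level]) (init_global coins) = level_state tau.
  elim: tau => [|t IH]; last by rewrite iterS IH level_stateS.
  by apply/funext => -[].
rewrite /run /=.
have weight2 v : exec (exec (level_state tau) step_weight) step_scale (inr v) =
    set_weight (scale v) (level_state tau (inr v)).
  rewrite {1}/exec {1}exec_weight /= {1}/step_scale /=.
  by have := in_alloc_weight tau v; rewrite exec_weight /= => ->.
apply/funext => -[u|v]; rewrite {1}/exec; last by rewrite weight2.
rewrite [exec _ step_scale (inl u)]/exec {1}exec_weight /= /step_tokens /=.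
rewrite /set_coins /set_tokens /=.
congr VState; congr tokens; rewrite /received -map_comp.
apply/eq_in_map => -[u'|v]; rewrite mem_neighbours //= => _.
rewrite -[X in in_alloc X _]/(level_state tau (inr v)).
by rewrite in_alloc_weight.
Qed.

End Sampling.
Lemma ohead_sort (l : seq (nat * nat)) (x : nat * nat) :
  ohead (sort (relpre fst leq) l) = Some x -> x \in l /\ forall y, y \in l -> (x.1 <= y.1)%N.
Proof.
have le_trans' : transitive (relpre (@fst nat nat) leq) by move=> ? ? ?; apply: leq_trans.
have : sorted (relpre fst leq) (sort (relpre fst leq) l).
  by apply: sort_sorted => ? ?; apply: leq_total.
have := mem_sort (relpre fst leq) l.
case: (sort _ l) => [//|z r] mem_zr /= zr [<-]; split; first by rewrite -mem_zr mem_head.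
move=> y; rewrite -mem_zr inE => /predU1P[-> //|yr].
by have /allP/(_ y yr) := order_path_min le_trans' zr.
Qed.

Lemma ohead_sort_none (l : seq (nat * nat)) : ohead (sort (relpre fst leq) l) = None -> l = [::].
Proof.
by case sl: (sort _ l) => [|//] _; apply/nilP; rewrite /nilp -(size_sort (relpre fst leq)) sl.
Qed.

(** * Execution of the auction phase *)

Section Auction.
Variables (coins : vertex G -> nat -> bool) (tau : nat).
Hypothesis k_gt0 : (0 < k)%N.

Definition name (u : L) : nat := id (inl u).
Definition tickets (u : L) (v : R) : nat :=
  count_mem (id (inr v)) (tokens e s (shares tau u) (coins (inl u))).

Definition auction_state (t : nat) : global :=
  iter t (run [:: step_bid; step_accept]) (sampled tau coins).
Definition bid_state (t : nat) : global := exec (auction_state t) step_bid.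

Definition accepted (t : nat) (v : R) : seq nat := st_accepted (auction_state t (inr v)).
(** Turns the identifier stored in a bid back into a vertex, the form used by the abstract
    auction. *)
Definition bid (t : nat) (u : L) : option R :=
  [pick v | st_bid (bid_state t (inl u)) == Some (id (inr v))].
Definition bidders (t : nat) (v : R) : seq nat :=
  [seq y.1 | y <- received (bid_state t) (inr v) & st_bid y.2 == Some (id (inr v))].

Lemma step_bid_static x m : [/\ st_id (step_bid x m) = st_id x,
  st_cap (step_bid x m) = st_cap x, st_tokens (step_bid x m) = st_tokens x &
  st_accepted (step_bid x m) = st_accepted x].
Proof. by rewrite /step_bid; case cx: (st_cap x). Qed.

Lemma step_accept_static x m : [/\ st_id (step_accept x m) = st_id x,
  st_cap (step_accept x m) = st_cap x & st_tokens (step_accept x m) = st_tokens x].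
Proof. by rewrite /step_accept; case cx: (st_cap x). Qed.

Lemma auction_stateS t : auction_state t.+1 = exec (bid_state t) step_accept.
Proof. by []. Qed.

Lemma auction_static t x : [/\ st_id (auction_state t x) = id x,
  st_cap (auction_state t x) = local_input x &
  st_tokens (auction_state t x) =
    if x is inl u then tokens e s (shares tau u) (coins x) else [::]].
Proof.
elim: t => [|t IH]; first by case: x.
rewrite auction_stateS /exec; have [-> -> ->] := step_accept_static (bid_state t x)
  (received (bid_state t) x).
by rewrite /bid_state /exec; have [-> -> -> _] := step_bid_static (auction_state t x)
  (received (auction_state t) x).
Qed.

Lemma bid_static t x : [/\ st_id (bid_state t x) = id x,
  st_cap (bid_state t x) = local_input x &
  st_accepted (bid_state t x) = st_accepted (auction_state t x)].
Proof.
rewrite /bid_state /exec; have [-> -> _ ->] := step_bid_static (auction_state t x)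
  (received (auction_state t) x).
by have [-> -> _] := auction_static t x.
Qed.

Lemma accepted0 v : accepted 0 v = [::]. Proof. by []. Qed.

Lemma acceptedS t v : accepted t.+1 v =
  accepted t v ++ take (C v - size (accepted t v) %% C v) (bidders t v).
Proof.
rewrite /accepted auction_stateS {1}/exec /step_accept.
by have [-> -> ->] := bid_static t (inr v).
Qed.

Lemma mem_bidders t v i : reflect
  (exists2 u, (u, v) \in E & i = name u /\ st_bid (bid_state t (inl u)) = Some (id (inr v)))
  (i \in bidders t v).
Proof.
rewrite /bidders /received filter_map -map_comp; apply: (iffP mapP) => [[y]|[u uv [-> bu]]].
  rewrite mem_filter mem_neighbours /=; case: y => [u|v'] /= /andP[/eqP bu // uv] ->.
  by exists u.
by exists (inl u) => //; rewrite mem_filter mem_neighbours /= uv bu eqxx.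
Qed.

Lemma bidders_uniq t v : uniq (bidders t v).
Proof.
rewrite /bidders /received filter_map -map_comp map_inj_uniq //.
by rewrite filter_uniq // neighbours_uniq.
Qed.

Lemma accepted_name t v i : i \in accepted t v -> exists2 u, (u, v) \in E & i = name u.
Proof.
elim: t => [//|t IH]; rewrite acceptedS mem_cat => /orP[/IH //|/mem_take/mem_bidders].
by case=> u uv [-> _]; exists u.
Qed.

Lemma holdersE t v : st_holders (auction_state t (inr v)) = holders C accepted t v.
Proof. by rewrite /st_holders; have [_ -> _] := auction_static t (inr v). Qed.

Lemma priceE t v : st_price (auction_state t (inr v)) = price C accepted t v.
Proof. by rewrite /st_price; have [_ -> _] := auction_static t (inr v). Qed.

Lemma name_inj : injective name. Proof. by move=> u u' /id_inj []. Qed.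

Lemma has_received_left (p : pred (nat * vstate)) (S : global) u :
  has p (received S (inl u)) = [exists v, ((u, v) \in E) && p (id (inr v), S (inr v))].
Proof.
rewrite has_map; apply/hasP/existsP => [[[u'|v]]|[v /andP[uv pv]]].
- by rewrite mem_neighbours.
- by rewrite mem_neighbours => uv pv; exists v; rewrite [_ \in _]uv.
- by exists (inr v) => //; rewrite mem_neighbours.
Qed.

(** Only neighbours of [v] can be its holders, so the inbox of [u] suffices to tell whether [u] is
    held. *)
Lemma heldE t u : has (fun y => id (inl u) \in st_holders y.2)
  (received (auction_state t) (inl u)) = held C name accepted t u.
Proof.
rewrite has_received_left; apply: eq_existsb => v /=; rewrite holdersE.
apply/andb_idl => /mem_drop /accepted_name[u' uv].
by move=> /name_inj ->.
Qed.

Lemma tickets_edge u v : (0 < tickets u v)%N -> (u, v) \in E.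
Proof.
rewrite /tickets -has_count has_pred1 /tokens mem_pmap => /mapP[j _ /esym/draw_name].
case/mapP=> -[i x] /mapP[y + [-> _]] /= iy.
by rewrite mem_neighbours; move/id_inj: iy => <-.
Qed.

Lemma st_bidE t u : st_bid (bid_state t (inl u)) =
  if held C name accepted t u then None
  else omap snd (ohead (sort (relpre fst leq)
    [seq (st_price y.2, y.1) | y <- received (auction_state t) (inl u)
       & (y.1 \in tokens e s (shares tau u) (coins (inl u))) && (st_price y.2 < k)%N])).
Proof.
rewrite /bid_state {1}/exec /step_bid.
by have [-> -> ->] := auction_static t (inl u); rewrite /= heldE.
Qed.

Lemma mem_offers t u p : reflect
  (exists2 v, (0 < tickets u v)%N && (price C accepted t v < k)%N &
     p = (price C accepted t v, id (inr v)))
  (p \in [seq (st_price y.2, y.1) | y <- received (auction_state t) (inl u)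
       & (y.1 \in tokens e s (shares tau u) (coins (inl u))) && (st_price y.2 < k)%N]).
Proof.
rewrite /received filter_map -map_comp; apply: (iffP mapP) => [[y]|[v /andP[tuv lt_k] ->]].
  rewrite mem_filter mem_neighbours /=; case: y => [u'|v] /= /andP[/andP[tv lt_k] // _] ->.
  by exists v; rewrite -priceE // lt_k andbT /tickets -has_count has_pred1.
exists (inr v); last by rewrite /= priceE.
rewrite mem_filter mem_neighbours /= priceE lt_k andbT tickets_edge // andbT.
by move: tuv; rewrite /tickets -has_count has_pred1.
Qed.

Lemma st_bid_edge t u i : st_bid (bid_state t (inl u)) = Some i ->
  exists2 v, i = id (inr v) &
  [/\ ~~ held C name accepted t u, (0 < tickets u v)%N, (price C accepted t v < k)%N
    & forall v', (0 < tickets u v')%N -> (price C accepted t v <= price C accepted t v')%N].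
Proof.
rewrite st_bidE; case: ifP => // free; case o: (ohead _) => [x|//] [<-].
have [/mem_offers[v /andP[tuv lt_k] ->] min_x] := ohead_sort o.
exists v => //; split=> // v' tuv'; have [le|lt] := leqP k (price C accepted t v').
  by rewrite (leq_trans (ltnW lt_k)).
by apply: (min_x (price C accepted t v', id (inr v'))); apply/mem_offers; exists v'; rewrite ?tuv'.
Qed.

Lemma bidP t u v : (bid t u == Some v) = (st_bid (bid_state t (inl u)) == Some (id (inr v))).
Proof.
rewrite /bid; case: pickP => [v' /eqP ->|none]; last by rewrite none.
by apply/eqP/eqP => [[->] //|[/id_inj[->]]].
Qed.

Lemma bid_some t u v : bid t u = Some v ->
  [/\ ~~ held C name accepted t u, (0 < tickets u v)%N, (price C accepted t v < k)%N
    & forall v', (0 < tickets u v')%N -> (price C accepted t v <= price C accepted t v')%N].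
Proof. by move/eqP; rewrite bidP => /eqP/st_bid_edge[v' /id_inj[->]]. Qed.

Lemma bid_none t u : bid t u = None ->
  held C name accepted t u \/
  forall v, (0 < tickets u v)%N -> (k <= price C accepted t v)%N.
Proof.
rewrite /bid; case: pickP => // none _.
case b: (st_bid (bid_state t (inl u))) => [i|].
  by have [v iv _] := st_bid_edge b; have := none v; rewrite b iv eqxx.
move: b; rewrite st_bidE; case: ifP => [held _|_]; first by left.
case o: (ohead _) => [//|] _; right => v tuv; rewrite leqNgt; apply/negP => lt_k.
have := ohead_sort_none o; set offers := [seq _ | _ <- _ & _] => no.
have : (price C accepted t v, id (inr v)) \in offers.
  by apply/mem_offers; exists v; rewrite ?tuv.
by rewrite no.
Qed.

Lemma biddersP t v u : (name u \in bidders t v) = (bid t u == Some v).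
Proof.
rewrite bidP; apply/mem_bidders/eqP => [[u' _ [/name_inj <-]] //|b].
by exists u => //; have [v' /id_inj[->] [_ /tickets_edge]] := st_bid_edge b.
Qed.

Lemma bidders_name t v i : i \in bidders t v -> exists u, i = name u.
Proof. by move=> /mem_bidders[u _ [-> _]]; exists u. Qed.

Lemma card_tickets u : (\sum_v tickets u v <= s)%N.
Proof.
apply: leq_trans (size_tokens e s (shares tau u) (coins (inl u))).
rewrite /tickets; elim: (tokens _ _ _ _) => [|i r IH] /=; first by rewrite big1.
rewrite big_split /= -add1n leq_add //.
have [[v <-]|none] := pselect (exists v, id (inr v) = i).
  rewrite (bigD1 v) //= eqxx big1 // => v' ne.
  by case: eqP => // /id_inj[vv']; rewrite vv' eqxx in ne.
by rewrite big1 // => v _; case: eqP => // iv; case: none; exists v.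
Qed.

Definition outcome (T : nat) : {set L * R} := matching C name accepted T.

Lemma outcome_edge T u v : (u, v) \in outcome T -> (u, v) \in E.
Proof.
move/(matching_tk (@cap_gt0 G) accepted0 acceptedS bid_some biddersP).
exact: tickets_edge.
Qed.

Lemma outcome_allocation T : allocation G (outcome T).
Proof.
apply/and3P; split.
- by apply/fintype.subsetP => -[u v]; apply: outcome_edge.
- apply/forallP => u; exact: (matching_left accepted0 acceptedS bid_some biddersP).
apply/forallP => v.
rewrite (card_matching_right name_inj accepted0 acceptedS bid_some (@bidders_uniq)
  biddersP bidders_name).
exact: geq_minr.
Qed.

Lemma outcome_value (T := (k * k * (1 + s))%N) :
  (k * \sum_v \sum_u tickets u v <=
   s * (k + 2) * #|outcome T| + 2 * k * \sum_v (\sum_u tickets u v - s * C v))%N.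
Proof.
exact: (auction_value (@cap_gt0 G) name_inj card_tickets accepted0
  acceptedS bid_some bid_none (@bidders_uniq) biddersP bidders_name k_gt0).
Qed.

End Auction.

Lemma final_state tau T lam coins :
  final (local_algorithm tau T) lam id coins =
  (fun x => ([::], exec (auction_state coins (tau lam) T) step_match x)).
Proof. by apply/funext => x; rewrite final_run run_cat run_sampling run_cat run_nseq. Qed.

(** Right vertices know their holders; the final [step_match] informs the left endpoints. *)
Lemma computes_outcome tau T lam coins :
  computes (local_algorithm tau T) lam id coins (outcome coins (tau lam) T).
Proof.
split=> [|u v uv]; first by case/and3P: (outcome_allocation coins (tau lam) T).
rewrite /output /= final_state /= /exec /step_match.
have [idu cu _] := auction_static coins (tau lam) T (inl u).
have [_ cv _] := auction_static coins (tau lam) T (inr v).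
have uvE : ((u, v) \in outcome coins (tau lam) T) =
    (id (inl u) \in st_holders (auction_state coins (tau lam) T (inr v))).
  by rewrite holdersE inE.
rewrite uvE idu cu cv /= cu cv; split=> //.
rewrite /received filter_map -map_comp; apply/mapP/idP => [[y]|h].
  by rewrite mem_filter /= => /andP[h _] /id_inj ->.
by exists (inr v); rewrite ?mem_filter ?mem_neighbours /= ?h.
Qed.

(** After sampling, the coins survive only through the tokens. Since these read finitely many coins,
    the outcome becomes a function on a finite cube. *)
Lemma eq_final tau T lam coins coins' :
  (forall u, tokens e s (shares (tau lam) u) (coins (inl u)) =
             tokens e s (shares (tau lam) u) (coins' (inl u))) ->
  final (local_algorithm tau T) lam id coins = final (local_algorithm tau T) lam id coins'.
Proof.
move=> eq_tok; rewrite !final_state /auction_state.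
have -> // : sampled (tau lam) coins = sampled (tau lam) coins'.
by apply/funext => -[u|v] //=; rewrite eq_tok.
Qed.

End Run.
End Program.

(** * Expected size of the outcome *)

Section Expectation.
Variables (K : realType) (k : nat).
Hypothesis k_gt1 : (1 < k)%N.
Local Notation e := (k%:R^-1 : K).
Local Notation s := (k * k)%N.
Variables (G : instance) (id : vertex G -> nat) (tau : nat).
Hypothesis id_inj : injective id.
Local Notation L := (lpart G).
Local Notation R := (rpart G).
Local Notation E := (edges G).
Local Notation C := (@cap G).
Local Notation f := (level E C e tau).
Local Notation shares := (shares e id tau).

Let k_gt0 : (0 < k)%N. Proof. exact: ltnW. Qed.
Let e_gt0 : 0 < e. Proof. by rewrite invr_gt0 ltr0n. Qed.
Let e_lt1 : e < 1. Proof. by rewrite invf_lt1 ?ltr0n // ltr1n. Qed.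

Lemma share_gt0 u v : (u, v) \in E -> 0 < share e tau u v.
Proof.
move=> uv; rewrite /share /scale mulr_gt0 ?divr_gt0 ?wgt_gt0 ?(lwt_gt0 e_gt0 f uv) //.
rewrite lt_min ltr01 /=; apply: divr_gt0; last exact: (alloc_gt0 e_gt0 _ uv).
by apply: mulr_gt0; rewrite ?subr_gt0 ?ltr0n ?cap_gt0.
Qed.

Lemma sum_share v : \sum_(u | (u, v) \in E) share e tau u v =
  Num.min (alloc E e f v) ((1 - e) * (C v)%:R).
Proof.
rewrite -mulr_suml -/(alloc E e f v) /scale.
have [a0|a0] := eqVneq (alloc E e f v) 0.
  by rewrite a0 mul0r min_l // mulr_ge0 ?subr_ge0 // ltW.
have a_gt0 : 0 < alloc E e f v by rewrite lt_neqAle eq_sym a0 alloc_ge0.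
by rewrite minr_pMr ?ltW // mulr1 mulrCA divff // mulr1.
Qed.

Lemma shares_sum u : \sum_(x <- shares u) x.2 <= 1.
Proof.
rewrite big_map sum_neighbours_left /=.
have [[v0 uv0]|none] := pselect (exists v, (u, v) \in E); last first.
  by rewrite big1 // => v uv; case: none; exists v.
apply: (@le_trans _ _ (\sum_(v | (u, v) \in E) wgt e (f v) / lwt E e f u)).
  apply: ler_sum => v uv; rewrite ler_piMr ?ge_min ?lexx //.
  by rewrite divr_ge0 ?lwt_ge0 // ltW ?wgt_gt0.
by rewrite -mulr_suml divff // gt_eqF // (lwt_gt0 e_gt0 f uv0).
Qed.

Lemma mem_shares u x : x \in shares u ->
  exists2 v, (u, v) \in E & x = (id (inr v), share e tau u v).
Proof. by case/mapP=> -[u'|v]; rewrite mem_neighbours //= => uv ->; exists v. Qed.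

Lemma shares_mem u v : (u, v) \in E -> (id (inr v), share e tau u v) \in shares u.
Proof. by move=> uv; apply/mapP; exists (inr v); rewrite ?mem_neighbours. Qed.

Lemma shares_uniq u : uniq [seq x.1 | x <- shares u].
Proof. by rewrite -map_comp map_inj_uniq ?neighbours_uniq. Qed.

Lemma shares_ge0 u x : x \in shares u -> 0 <= x.2.
Proof. by case/mem_shares => v uv ->; rewrite ltW ?share_gt0. Qed.

(** Draw [j] of [u] reads the coins of index [i * s + j] with [j < s] and [i] below the precision,
    all of which lie below this bound. *)
Definition coin_bound : nat := (s * \max_u precision e (shares u))%N.
Local Notation B := coin_bound.
Local Notation coin_table := {ffun vertex G * 'I_B -> bool}.

Definition extend (b : coin_table) (x : vertex G) (i : nat) : bool :=
  if insub i is Some i' then b (x, i') else false.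

Lemma extendE b x (i : nat) (iB : (i < B)%N) : extend b x i = b (x, Ordinal iB).
Proof. by rewrite /extend insubT. Qed.

Lemma position_lt u (j : 'I_s) (i : 'I_(precision e (shares u))) : (i * s + j < B)%N.
Proof.
apply: (@leq_trans (i.+1 * s)%N); first by rewrite mulSn addnC ltn_add2r.
by rewrite /B mulnC leq_mul2l (leq_trans (ltn_ord i)) ?orbT // leq_bigmax.
Qed.

Lemma tokens_extend (coins : nat -> bool) (b : coin_table) u :
  (forall i (iB : (i < B)%N), coins i = b (inl u, Ordinal iB)) ->
  tokens e s (shares u) coins = tokens e s (shares u) (extend b (inl u)).
Proof.
move=> eq_b; apply: eq_in_pmap => j; rewrite mem_iota add0n => /andP[_ js].
rewrite /draw; congr onth; congr (nat_of_ord (enum_rank _)); apply/ffunP => i; rewrite !ffunE.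
have iB : (i * s + j < B)%N := position_lt (Ordinal js) i.
by rewrite (eq_b _ iB) -extendE.
Qed.

Let hit (u : L) (j : 'I_s) (v : R) (b : coin_table) : bool :=
  draw e s (shares u) (extend b (inl u)) j == Some (id (inr v)).
Let prob (u : L) (v : R) : K :=
  if (u, v) \in E then
    (weight e (shares u) (share e tau u v))%:R / (2 ^ precision e (shares u))%:R
  else 0.

Lemma draw_extend u (j : 'I_s) b : draw e s (shares u) (extend b (inl u)) j =
  onth (table e (shares u)) (enum_rank
    [ffun i : 'I_(precision e (shares u)) => b (inl u, Ordinal (position_lt j i))]).
Proof.
rewrite /draw; congr onth; congr (nat_of_ord (enum_rank _)); apply/ffunP => i.
by rewrite !ffunE (extendE _ _ (position_lt j i)).
Qed.

Lemma mean_hit u j v : mean (fun b => (hit u j v b)%:R) = prob u v.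
Proof.
rewrite /prob; case: ifP => uv; last first.
  rewrite -[RHS](mean_cst (cube_gt0 (vertex G * 'I_B)%type)); apply: eq_mean => b; rewrite /hit.
  case: eqP => // /draw_name /mapP[x /mem_shares[v' uv' ->] /= /id_inj[vv']].
  by rewrite vv' uv' in uv.
rewrite -(count_table e (shares_uniq u) (shares_mem uv)).
rewrite -(sum_count_onth _ (size_table e (@shares_ge0 u) (shares_sum u))) natr_sum.
pose pos (i : 'I_(precision e (shares u))) : vertex G * 'I_B :=
  (inl u, Ordinal (position_lt j i)).
pose h (a : {ffun 'I_(precision e (shares u)) -> bool}) : K :=
   (onth (table e (shares u)) (enum_rank a) == Some (id (inr v)))%:R.
have pos_inj : injective pos.
  move=> i i' [] /eqP; rewrite eqn_add2r eqn_pmul2r ?muln_gt0 ?k_gt0 // => /eqP.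
  exact: val_inj.
apply: etrans (mean_restrict h pos_inj).
by apply: eq_mean => b; rewrite /hit draw_extend.
Qed.

(** Distinct left vertices read their own coins, and distinct draws of one vertex read different
    residues modulo [s]. *)
Lemma mean_hit2 u j u' j' v : (u, j) != (u', j') ->
  mean (fun b => (hit u j v b)%:R * (hit u' j' v b)%:R) = prob u v * prob u' v.
Proof.
move=> ne; rewrite -(mean_hit u j) -(mean_hit u' j').
pose S u (j : 'I_s) (x : vertex G * 'I_B) := (x.1 == inl u) && (x.2 %% s == j)%N.
have hitS u1 j1 : depends_on (S u1 j1) (fun b => (hit u1 j1 v b)%:R : K).
  move=> b b' bb'; rewrite /hit !draw_extend.
  congr ((onth _ (enum_rank _) == _)%:R); apply/ffunP => i; rewrite !ffunE bb' //.
  by rewrite /S eqxx /= modnMDl modn_small.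
apply: (mean_indep (S := S u j) (S' := S u' j')) => // -[x i].
move=> /andP[/= /eqP -> /eqP ij] /andP[/= /eqP[uu'] /eqP ij'].
by case/eqP: ne; rewrite uu'; congr pair; apply: val_inj; rewrite /= -ij -ij'.
Qed.

Let load (b : coin_table) (v : R) : nat := (\sum_u tickets e s id (extend b) tau u v)%N.
Let total : K := \sum_v \sum_u prob u v.

Lemma load_hits b v : load b v = (\sum_(x : L * 'I_s) hit x.1 x.2 v b)%N.
Proof.
rewrite /load -(pair_bigA _ (fun u j => hit u j v b : nat)) /=; apply: eq_bigr => u _.
exact: count_tokens.
Qed.

Lemma sum_prob_hits v : \sum_(x : L * 'I_s) prob x.1 v = s%:R * \sum_u prob u v.
Proof.
rewrite -(pair_bigA _ (fun u (j : 'I_s) => prob u v)) /= mulr_sumr; apply: eq_bigr => u _.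
by rewrite sumr_const card_ord mulr_natl.
Qed.

Lemma prob_le v : \sum_u prob u v <= (1 - e) * (C v)%:R.
Proof.
apply: (@le_trans _ _ (\sum_(u | (u, v) \in E) share e tau u v)).
  rewrite [leRHS]big_mkcond; apply: ler_sum => u _; rewrite /prob; case: ifP => // uv.
  by rewrite ler_pdivrMr ?ltr0n ?expn_gt0 // weight_le // ltW ?share_gt0.
by rewrite sum_share ge_min lexx orbT.
Qed.

(** One factor [1 - e] pays for the scaling, the other for the rounding of the probabilities. *)
Lemma total_ge : (1 - e) ^+ 2 * \sum_v sat E C e f v <= total.
Proof.
rewrite /total mulr_sumr; apply: ler_sum => v _.
apply: (@le_trans _ _ ((1 - e) * \sum_(u | (u, v) \in E) share e tau u v)).
  rewrite expr2 -mulrA ler_pM2l ?subr_gt0 // sum_share /sat.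
  rewrite le_min ler_pM2l ?subr_gt0 // ge_min lexx andbT.
  apply: (@le_trans _ _ (sat E C e f v)); last by rewrite /sat ge_min lexx orbT.
  by rewrite ler_piMl ?sat_ge0 // gerBl ltW.
rewrite mulr_sumr [leLHS]big_mkcond; apply: ler_sum => u _; rewrite /prob; case: ifP => // uv.
rewrite ler_pdivlMr ?ltr0n ?expn_gt0 // -mulrA.
by apply: weight_ge (shares_mem uv) _ => //; apply: share_gt0.
Qed.

Lemma mean_load : mean (fun b => (\sum_v load b v)%:R) = s%:R * total.
Proof.
have -> : mean (fun b => (\sum_v load b v)%:R) =
    mean (fun b => \sum_v \sum_(x : L * 'I_s) (hit x.1 x.2 v b)%:R : K).
  apply: eq_mean => b; rewrite natr_sum; apply: eq_bigr => v _.
  by rewrite load_hits natr_sum.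
rewrite mean_sum /total mulr_sumr; apply: eq_bigr => v _.
rewrite mean_sum -sum_prob_hits; apply: eq_bigr => x _; exact: mean_hit.
Qed.

(** [mean_excess] is applied at each [v] with [c = s * C v]. As [s * total] tokens are expected and
    [s = k * k], the excess is at most a fraction [e / 4] of them. *)
Lemma mean_over : 4 * e * mean (fun b => (\sum_v (load b v - s * C v))%:R) <= total.
Proof.
have -> : mean (fun b => (\sum_v (load b v - s * C v))%:R) =
    \sum_v mean (fun b => (load b v - s * C v)%:R : K).
  by rewrite -mean_sum; apply: eq_mean => b; rewrite natr_sum.
rewrite mulr_sumr; apply: ler_sum => v _.
have s_gt0 : 0 < s%:R :> K by rewrite ltr0n muln_gt0 k_gt0.
have cheb : 4 * e * (s * C v)%:R * mean (fun b => (load b v - s * C v)%:R) <=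
    \sum_(x : L * 'I_s) prob x.1 v.
  have -> : mean (fun b => (load b v - s * C v)%:R) =
      mean (fun b => (\sum_(x : L * 'I_s) hit x.1 x.2 v b - s * C v)%:R) :> K.
    by apply: eq_mean => b; rewrite load_hits.
  apply: mean_excess => //; first exact: cube_gt0.
  - by move=> x; apply: mean_hit.
  - by move=> [u j] [u' j']; apply: mean_hit2.
  rewrite sum_prob_hits (natrM _ s) mulrCA ler_pM2l //; exact: prob_le.
rewrite sum_prob_hits (natrM _ s) in cheb.
rewrite -(ler_pM2l s_gt0); apply: le_trans cheb.
rewrite [leRHS](_ : _ = s%:R * (C v)%:R *
  (4 * e * mean (fun b => (load b v - s * C v)%:R))); last by ring.
rewrite -[leRHS]mulrA ler_pM2l // ler_peMl ?ler1n ?cap_gt0 //.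
apply: mulr_ge0; first by rewrite mulr_ge0 ?ltW.
rewrite -[X in X <= _](mean_cst (cube_gt0 (vertex G * 'I_B)%type)).
by apply: le_mean => [|b]; rewrite ?cube_gt0.
Qed.

Lemma mean_outcome (lam w : nat) (M : {set L * R}) :
  (forall (A : {set L}) (B : {set R}),
     (#|E :&: finset.setX A B| <= lam * (#|A| + #|B|))%N) ->
  lam%:R * wgt e w <= e ->
  tau = (k * w).+1 ->
  allocation G M ->
  (1 - 8 * e) * #|M|%:R <=
    mean (fun b => #|outcome e s k id (extend b) tau (k * k * (1 + s))|%:R : K).
Proof.
move=> dens lam_w tau_def /and3P[ME /forallP ML /forallP MR].
set m := mean _; set Y := total; set O := #|M|%:R.
have := cover_value e_gt0 (@cap_gt0 G) k dens lam_w ME ML MR.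
rewrite -tau_def -/O; set P := \sum_v _ => cover.
have YP : (1 - e) ^+ 2 * P <= Y := total_ge.
have mY : k%:R * (s%:R * Y) <= s%:R * (k + 2)%:R * m + 2 * k%:R * (k%:R / 4 * Y).
  rewrite -mean_load -meanZ.
  apply: (@le_trans _ _ (mean (fun b => s%:R * (k + 2)%:R *
      #|outcome e s k id (extend b) tau (k * k * (1 + s))|%:R +
      2 * k%:R * (\sum_v (load b v - s * C v))%:R : K))).
    apply: le_mean => [|b]; first exact: cube_gt0.
    rewrite -!natrM -natrD ler_nat; exact: outcome_value.
  rewrite meanD !meanZ lerD2l ler_wpM2l ?mulr_ge0 //.
  have := mean_over; rewrite -/Y; set z := mean _ => zY.
  have -> : z = k%:R / 4 * (4 * e * z) by field; rewrite pnatr_eq0 -lt0n.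
  by rewrite ler_wpM2l // divr_ge0.
have k_pos : 0 < k%:R :> K by rewrite ltr0n.
have k_e : k%:R * e = 1 :> K by rewrite divff // gt_eqF.
(* This is [mY] divided by [k ^ 3], with [s = k * k]. *)
have mY' : (1 - e / 2) * Y <= (1 + 2 * e) * m.
  rewrite -(ler_pM2l (mulr_gt0 (mulr_gt0 k_pos k_pos) k_pos)).
  move: mY; rewrite natrM natrD => mY.
  have -> : k%:R * k%:R * k%:R * ((1 - e / 2) * Y) =
     k%:R * (k%:R * k%:R * Y) - 2 * k%:R * (k%:R / 4 * Y) by field; rewrite pnatr_eq0 -lt0n.
  have -> : k%:R * k%:R * k%:R * ((1 + 2 * e) * m) =
     k%:R * k%:R * (k%:R + 2) * m by field; rewrite pnatr_eq0 -lt0n.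
  by rewrite lerBlDr.
(* Here [k + 1 = k * (1 + e)] supplies the second factor [1 + e]. *)
have OP : (1 - e) * O <= (1 + e) ^+ 2 * P.
  rewrite -(ler_pM2l k_pos) mulrA; apply: le_trans cover _.
  rewrite le_eqVlt; apply/orP; left; apply/eqP; rewrite -natr1.
  by field; rewrite pnatr_eq0 -lt0n.
have O_ge0 : 0 <= O by [].
have pos : 0 < (1 + e) ^+ 2 * (1 + 2 * e) by rewrite mulr_gt0 ?exprn_gt0 ?addr_gt0 ?mulr_gt0.
rewrite -(ler_pM2l pos).
apply: (@le_trans _ _ ((1 - e / 2) * (1 - e) ^+ 2 * ((1 - e) * O))).
  (* The difference expands into a polynomial in [e] whose coefficients are all nonnegative. *)
  rewrite -subr_ge0 (_ : _ - _ =
      (e / 2 + e ^+ 2 * (63 / 2) + e ^+ 3 * (71 / 2) + e ^+ 4 * (33 / 2)) * O).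
    by rewrite mulr_ge0 // !addr_ge0 ?mulr_ge0 ?exprn_ge0 ?ltW // divr_gt0.
  by field; rewrite pnatr_eq0 -lt0n.
have e2_ge0 : 0 <= 1 - e / 2 by have := e_gt0; have := e_lt1; lra.
apply: (@le_trans _ _ ((1 - e / 2) * (1 - e) ^+ 2 * ((1 + e) ^+ 2 * P))).
  by rewrite ler_wpM2l // mulr_ge0 // exprn_ge0 // subr_ge0 ltW.
rewrite [leLHS](_ : _ = (1 + e) ^+ 2 * ((1 - e / 2) * ((1 - e) ^+ 2 * P))); last by ring.
rewrite -[leRHS]mulrA ler_pM2l ?exprn_gt0 ?addr_gt0 //.
by apply: le_trans mY'; rewrite ler_wpM2l.
Qed.

End Expectation.

(** * Success probability *)

(** The event is a finite disjoint union of cylinders, all of the same probability. *)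
Lemma fair_coins_table (R : realType) (d : measure_display) (Omega : measurableType d)
    (P : probability Omega R) (V : finType) (coin : V -> nat -> Omega -> bool) (B : nat)
    (S : pred {ffun V * 'I_B -> bool}) :
  fair_coins P coin ->
  let event := [set w | S [ffun x : V * 'I_B => coin x.1 x.2 w]]%classic in
  measurable event /\
  P event = (#|S|%:R / #|{: {ffun V * 'I_B -> bool}}|%:R)%:E.
Proof.
move=> [mcoin fair] event.
pose cyl (b : {ffun V * 'I_B -> bool}) :=
  [set w | [ffun x : V * 'I_B => coin x.1 x.2 w] = b]%classic.
have mcyl b : measurable (cyl b).
  have -> : cyl b = (\bigcap_(x in [set: V * 'I_B]) [set w | coin x.1 x.2 w = b x])%classic.
    apply/seteqP; split=> w /= bw.
    by move=> x _ /=; rewrite -bw ffunE.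
    by apply/ffunP => x; rewrite ffunE; apply: bw.
  apply: fin_bigcap_measurable => // x _; case: (b x); first exact: mcoin.
  have -> : [set w | coin x.1 x.2 w = false]%classic = (~` [set w | coin x.1 x.2 w])%classic.
    by apply/seteqP; split=> w /=; case: (coin _ _ w).
  exact: measurableC.
have Pcyl b : P (cyl b) = (#|{: {ffun V * 'I_B -> bool}}|%:R^-1)%:E.
  pose bb x i := if insub i is Some i' then b (x, i') else false.
  rewrite card_ffun card_bool card_prod card_ord natrX -exprVn -(fair B bb).
  congr (P _); apply/seteqP; split=> w /= bw.
    by move=> x i iB; rewrite /bb insubT -bw ffunE.
  apply/ffunP => -[x i]; rewrite ffunE /= bw // /bb insubT //= => iB.
  by congr (b (x, _)); apply: val_inj.
have eventE : event = (\bigcup_(b in [set` enum S]) cyl b)%classic.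
  apply/seteqP; split=> w /=.
    by move=> Sw; exists [ffun x : V * 'I_B => coin x.1 x.2 w] => //=; rewrite mem_enum.
  by move=> [b /=]; rewrite mem_enum => Sb bw; rewrite /event /= bw.
split; first by rewrite eventE; apply: fin_bigcup_measurable.
rewrite eventE measure_fin_bigcup //; last first.
  by move=> b b' _ _ [w [/= <- <-]].
rewrite -(fsbig_seq _ _ (enum_uniq S)) (eq_bigr _ (fun b _ => Pcyl b)) sumEFin; congr (_%:E).
by rewrite big_enum /= sumr_const mulr_natl.
Qed.

(** * Width of a window *)

Definition window (R : realType) (e : R) (lam : nat) : nat :=
  (Num.truncn ((ln lam%:R - ln e) / ln (1 + e))).+1.

(** For [lam > 0] the window exceeds the logarithm of [lam / e] in base [1 + e]. *)
Lemma window_wgt (R : realType) (e : R) (lam : nat) : 0 < e ->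
  lam%:R * wgt e (window e lam) <= e.
Proof.
move=> e0; case: lam => [|lam]; first by rewrite mul0r ltW.
have e1 : 0 < 1 + e by rewrite addr_gt0.
have l0 : 0 < ln (1 + e) by rewrite ln_gt0 // ltrDl.
rewrite /wgt ler_pdivrMr ?exprn_gt0 //.
rewrite -ler_ln ?posrE ?mulr_gt0 ?exprn_gt0 //.
rewrite lnM ?posrE ?exprn_gt0 // lnXn // -lerBlDl -[ln _ *+ _]mulr_natl -ler_pdivrMr //.
by rewrite ltW // Num.Theory.truncnS_gt.
Qed.

Lemma window_le (R : realType) (e : R) (lam : nat) : 0 < e -> e < 1 ->
  (window e lam)%:R <= ln lam%:R / ln (1 + e) + (1 - ln e / ln (1 + e)).
Proof.
move=> e0 lt_e1.
have l0 : 0 < ln (1 + e) by rewrite ln_gt0 // ltrDl.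
(* For [lam = 0] this relies on the convention [ln 0 = 0]. *)
have lam0 : 0 <= ln lam%:R :> R.
  by case: lam => [|lam]; [rewrite ln0|rewrite ln_ge0 // ler1n].
rewrite /window -natr1 -lerBrDr.
have -> : ln lam%:R / ln (1 + e) + (1 - ln e / ln (1 + e)) - 1 =
  (ln lam%:R - ln e) / ln (1 + e) by ring.
rewrite Num.Theory.truncn_le; apply: divr_ge0; last exact: ltW.
rewrite subr_ge0 (le_trans _ lam0) //.
by rewrite ltW // ln_lt0 // e0.
Qed.

Lemma opt_attained (G : instance) : exists2 M, allocation G M & opt G = #|M|.
Proof.
have alloc0 : allocation G finset.set0.
  have none (p : pred (lpart G * rpart G)) n :
      (#|[set x in (finset.set0 : {set lpart G * rpart G}) | p x]| <= n)%N.
    by rewrite eq_card0 // => x; rewrite finset.inE finset.in_set0.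
  by apply/and3P; split; [exact: finset.sub0set|apply/forallP => u|apply/forallP => v]; apply: none.
have : (0 < #|allocation G|)%N by apply/card_gt0P; exists finset.set0; exact: alloc0.
move=> /(eq_bigmax_cond (fun M : {set lpart G * rpart G} => #|M|))[M aM optM].
by exists M.
Qed.

Lemma card_le_opt (G : instance) M : allocation G M -> (#|M| <= opt G)%N.
Proof. by move=> aM; apply: leq_bigmax_cond. Qed.

(** Markov's inequality for the deficit [O - X w]: outside [S] it exceeds [r * O] with
    [r = eps / (1 + eps)], while its mean is at most [8 * e * O], hence at most [delta * r * O]. *)
Lemma markov_deficit (R : realType) (Om : finType) (X : Om -> nat) (O : nat)
    (eps delta e : R) (S : pred Om) :
  (0 < #|Om|)%N -> 0 < eps -> 0 < delta ->
  8 * e <= delta * (eps / (1 + eps)) ->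
  (forall w, (X w <= O)%N) ->
  (forall w, O%:R <= (1 + eps) * (X w)%:R -> S w) ->
  (1 - 8 * e) * O%:R <= mean (fun w => (X w)%:R : R) ->
  1 - delta <= #|S|%:R / #|Om|%:R.
Proof.
move=> Om_gt0 eps_gt0 delta_gt0 e_small X_le XS mean_ge.
have meanS : mean (fun w => (S w)%:R : R) = #|S|%:R / #|Om|%:R.
  by rewrite /mean -natr_sum -sum1_card [in RHS]big_mkcond.
have [eq0|O_gt0] := posnP O.
  have mean1 : mean (fun w => (S w)%:R : R) = 1.
    rewrite -[RHS](mean_cst Om_gt0).
    by apply: eq_mean => w; rewrite XS // eq0 mulr_ge0 // addr_ge0 // ltW.
  by rewrite -meanS mean1 gerBl ltW.
rewrite -meanS.
have O_pos : 0 < O%:R :> R by rewrite ltr0n.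
pose r := eps / (1 + eps).
have r_gt0 : 0 < r by rewrite divr_gt0 // addr_gt0.
have : mean (fun w => (X w)%:R : R) <= mean (fun w => (1 - r) * O%:R + r * O%:R * (S w)%:R).
  apply: le_mean => // w; case Sw: (S w).
    by rewrite mulr1 -mulrDl subrK mul1r ler_nat.
  rewrite mulr0 addr0; have : ~~ (O%:R <= (1 + eps) * (X w)%:R).
    by apply/negP => /XS; rewrite Sw.
  rewrite -ltNge => /ltW lt; have -> : 1 - r = (1 + eps)^-1.
    by rewrite /r; field; rewrite gt_eqF // addr_gt0.
  by rewrite ler_pdivlMl ?addr_gt0.
rewrite meanD mean_cst // meanZ => mean_le.
have := le_trans mean_ge mean_le; rewrite -/r in e_small.
move: (mean _) => m; rewrite -subr_ge0.
have -> : (1 - r) * O%:R + r * O%:R * m - (1 - 8 * e) * O%:R =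
  (8 * e - r * (1 - m)) * O%:R by ring.
rewrite pmulr_lge0 // subr_ge0 => le8.
have : r * (1 - m) <= r * delta by rewrite (le_trans le8) // [leRHS]mulrC.
by rewrite ler_pM2l // lerBlDr -lerBlDl.
Qed.

Theorem theorem1 (R : realType) (eps delta : R)
    (eps_gt0 : 0 < eps) (delta_gt0 : 0 < delta) :
  exists K : R, forall c : nat, exists A : algorithm,
    (forall lam : nat, (rounds A lam)%:R <= K * (1 + ln lam%:R)) /\
    (forall (G : instance) (lam : nat) (id : vertex G -> nat)
            (d : measure_display) (Omega : measurableType d)
            (P : probability Omega R) (coin : vertex G -> nat -> Omega -> bool),
       arboricity G lam ->
       injective id ->
       (forall x, id x < #|vertex G| ^ c)%N ->
       fair_coins P coin ->
       let good : set Omega :=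
         [set w | computes_approx A lam id eps (fun x i => coin x i w)]%classic in
       measurable good /\ ((1 - delta)%:E <= P good)%E).
Proof.
pose r := delta * (eps / (1 + eps)).
have r_gt0 : 0 < r by rewrite mulr_gt0 // divr_gt0 // addr_gt0.
(* [k] makes the expected relative deficit [8 / k] small enough for Markov's inequality. *)
have [k k_gt1 k_large] : exists2 k : nat, (1 < k)%N & 8 * k%:R^-1 <= r.
  exists (Num.truncn (8 / r)).+2 => //.
  rewrite ler_pdivrMr ?ltr0n // mulrC -ler_pdivrMr //.
  by rewrite ltW // (lt_le_trans (Num.Theory.truncnS_gt _)) // ler_nat.
pose e : R := k%:R^-1; pose s := (k * k)%N; pose T := (k * k * (1 + s))%N.
have e_gt0 : 0 < e by rewrite invr_gt0 ltr0n ltnW.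
have e_lt1 : e < 1 by rewrite invf_lt1 ?ltr0n ?ltr1n // ltnW.
pose l := ln (1 + e).
have l_gt0 : 0 < l by rewrite ln_gt0 // ltrDl.
pose tau lam := (k * window e lam).+1.
(* Each fractional round and each auction round takes two steps; the 6 counts the four remaining
   steps and the extra fractional round in [tau]. *)
exists (2 * k%:R * (l^-1 + (1 - ln e / l)) + 2 * T%:R + 6) => c.
exists (local_algorithm e s k tau T); split=> [lam|].
  have lam_ge0 : 0 <= ln lam%:R :> R.
    by case: lam => [|lam]; [rewrite ln0|rewrite ln_ge0 // ler1n].
  have -> : rounds (local_algorithm e s k tau T) lam = (2 * k * window e lam + 2 * T + 6)%N.
    by rewrite /= size_program /tau; lia.
  have c_ge0 : 0 <= 1 - ln e / l.
    rewrite subr_ge0 (@le_trans _ _ 0) // mulr_le0_ge0 ?invr_ge0 ?(ltW l_gt0) //.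
    by rewrite ltW // ln_lt0 ?e_gt0.
  have := window_le lam e_gt0 e_lt1; rewrite -/l.
  rewrite (natrD _ _ 6) (natrD _ (2 * k * window e lam)%N) (natrM _ (2 * k)%N).
  rewrite (natrM _ 2 k) (natrM _ 2 T).
  move: (window e lam)%:R => w w_le.
  have : 2 * k%:R * w <= 2 * k%:R * (ln lam%:R * l^-1 + (1 - ln e / l)).
    by rewrite ler_wpM2l.
  have : 0 <= 2 * k%:R * l^-1 :> R by rewrite mulr_ge0 // invr_ge0 ltW.
  have : 0 <= 2 * k%:R * (1 - ln e / l) * ln lam%:R by rewrite !mulr_ge0.
  have : 0 <= T%:R * ln lam%:R :> R by rewrite mulr_ge0.
  move: (1 - ln e / l) => q; move: k%:R T%:R l^-1 (ln lam%:R) lam_ge0 => kk t z y.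
  nra.
move=> G lam id d Omega P coin arb id_inj _ fair good.
set A := local_algorithm e s k tau T in good *.
pose B := coin_bound R k id (tau lam).
pose S (b : {ffun vertex G * 'I_B -> bool}) := `[<computes_approx A lam id eps (extend b)>].
(* Success depends only on the coins of index below [B], which gives both measurability and a
   probability computed by counting. *)
have goodE : good = [set w | S [ffun x : vertex G * 'I_B => coin x.1 x.2 w]]%classic.
  have approxE w : computes_approx A lam id eps (fun x i => coin x i w) =
      computes_approx A lam id eps (extend [ffun x : vertex G * 'I_B => coin x.1 x.2 w]).
    rewrite /computes_approx /computes.
    have -> // : final A lam id (fun x i => coin x i w) =
      final A lam id (extend [ffun x : vertex G * 'I_B => coin x.1 x.2 w]).
    by apply: eq_final => u; apply: tokens_extend => i iB; rewrite ffunE.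
  by apply/seteqP; split=> w; rewrite /good /S /= approxE => /asboolP.
have [mgood Pgood] := fair_coins_table S fair; rewrite goodE; split=> //.
rewrite Pgood lee_fin.
have [M aM optM] := opt_attained G.
apply: (markov_deficit (X := fun b => #|outcome e s k id (extend b) (tau lam) T|)
  (O := opt G) (eps := eps) (e := e)) => //.
- exact: cube_gt0.
- move=> b; apply: card_le_opt; exact: outcome_allocation.
- move=> b approx_b; apply/asboolP; exists (outcome e s k id (extend b) (tau lam) T).
  split=> //; last exact: outcome_allocation.
  exact: computes_outcome.
rewrite optM; apply: (mean_outcome k_gt1 id_inj (lam := lam) (w := window e lam)) => //.
  by move=> X Y; apply: arboricity_density.
exact: window_wgt.
Qed.
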